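(* Let $V$ be a finite-dimensional real normed space, $m\ge 1$ an integer and $p\ge 1$ a real number. Then $C^{p\text{-}var}(G^{m}(V))$, with the metric $d_{p\text{-}var}$, is complete.
   Context: $T^{(m)}(V)=\bigoplus_{n=0}^{m}V^{\otimes n}$ is the truncated tensor algebra with (truncated) product $\otimes$; $\mathcal{G}^{m}(V)$ is its Lie subalgebra generated by $V$ for the bracket $[a,b]=a\otimes b-b\otimes a$; $G^{m}(V)=\exp(\mathcal{G}^{m}(V))$ is the free nilpotent Lie group of step $m$ over $V$, with product $\otimes$ and neutral element $1$. The dilation is $\delta_{t}(1+v_{1}+\dots+v_{m})=1+tv_{1}+\dots+t^{m}v_{m}$, $v_i\in V^{\otimes i}$, $t\in\mathbb{R}$. $\|\cdot\|_{m}$ is a fixed symmetric subadditive homogeneous norm on $G^{m}(V)$, i.e. a function $G^m(V)\to[0,\infty)$ with $\|g\|_m=0$ iff $g=1$, $\|\delta_t g\|_m=|t|\,\|g\|_m$, $\|g\otimes h\|_m\le\|g\|_m+\|h\|_m$, $\|g^{-1}\|_m=\|g\|_m$ (for instance the Carnot–Caratheodory norm; all such norms are equivalent since $\dim V<\infty$). Set $d_{m}(g,h)=\|g^{-1}\otimes h\|_{m}$. A $G^m(V)$-valued path is a continuous map $[0,1]\to G^{m}(V)$ starting at $1$; for such a path $Y_{s,t}:=Y_{s}^{-1}\otimes Y_{t}$. $d_{p\text{-}var}(x,y)=\sup_{D=(0=t_{0}<\cdots<t_{n}=1)}\big(\sum_{i=0}^{n-1}d_{m}(x_{t_{i},t_{i+1}},y_{t_{i},t_{i+1}})^{p}\big)^{1/p}$,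 and $C^{p\text{-}var}(G^{m}(V))$ is the set of $G^m(V)$-valued paths at finite $d_{p\text{-}var}$-distance from the constant path $1$. *)

(* Defs.v *)
From HB Require Import structures.
From mathcomp Require Import all_boot all_order all_algebra.
From mathcomp Require Import all_classical all_reals all_analysis.
Set Implicit Arguments.
Unset Strict Implicit.
Unset Printing Implicit Defensive.
Import Order.TTheory GRing.Theory Num.Theory.
Import numFieldNormedType.Exports.
Local Open Scope classical_set_scope.
Local Open Scope ring_scope.

#[short(type="normedVectType")]
HB.structure Definition NormedVector (K : numFieldType) :=
  {V of NormedModule K V & Vector K V}.

(* With e_0, ..., e_(d-1) the basis [vbasis {:V}] of V, the tensors
   e_(i_1) (x) ... (x) e_(i_n) form a basis of the n-th tensor power of V.  An
   element of the truncated tensor algebra T^(m)(V) is represented by its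
   coordinates on these basis tensors, indexed by the words i_1 ... i_n of
   length n <= m (the empty word indexing the scalar component). *)
Definition ttensor (F : fieldType) (V : vectType F) (m : nat) : Type :=
  {ffun m.-bseq 'I_(\dim {:V}) -> F^o}.

Section TruncatedTensorAlgebra.
Context {F : fieldType} {V : vectType F} {m : nat}.
Local Notation d := (\dim {:V}).
Local Notation T := (ttensor V m).

HB.instance Definition _ := Vector.copy T {ffun m.-bseq 'I_d -> F^o}.

Implicit Types (a b c : T) (s w : seq 'I_d).

Definition tcoef a s : F :=
  if insub s is Some w then (a : {ffun m.-bseq 'I_d -> F^o}) w else 0.

Definition ttensor_of (f : seq 'I_d -> F) : T :=
  [ffun w : m.-bseq 'I_d => f w : F^o].

Lemma tcoef_of f s : (size s <= m)%N -> tcoef (ttensor_of f) s = f s.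
Proof.
move=> sm; rewrite /tcoef; case: insubP => [w _ ws|]; last by rewrite sm.
by rewrite ffunE ws.
Qed.

Lemma tcoef_long a s : (m < size s)%N -> tcoef a s = 0.
Proof. by rewrite ltnNge /tcoef => ms; rewrite insubN. Qed.

Lemma ttensorP a b :
  (forall s, (size s <= m)%N -> tcoef a s = tcoef b s) -> a = b.
Proof.
move=> ab; apply/ffunP => w; have := ab w (size_bseq w).
by rewrite /tcoef; case: insubP => [u _ /val_inj ->//|]; rewrite size_bseq.
Qed.

Lemma tcoefD a b s : tcoef (a + b) s = tcoef a s + tcoef b s.
Proof. by rewrite /tcoef; case: insub => [w|]; rewrite ?ffunE ?addr0. Qed.

Lemma tcoefZ (k : F) a s : tcoef (k *: a) s = k * tcoef a s.
Proof. by rewrite /tcoef; case: insub => [w|]; rewrite ?ffunE ?mulr0. Qed.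

Lemma tcoef0 s : tcoef 0 s = 0.
Proof. by rewrite -(scale0r 0) tcoefZ mul0r. Qed.

Lemma tcoefN a s : tcoef (- a) s = - tcoef a s.
Proof. by rewrite -scaleN1r tcoefZ mulN1r. Qed.

Lemma tcoef_sum I (r : seq I) (P : pred I) (G : I -> T) s :
  tcoef (\sum_(i <- r | P i) G i) s = \sum_(i <- r | P i) tcoef (G i) s.
Proof. by elim/big_rec2: _ => [|i x y _ <-]; rewrite ?tcoef0 ?tcoefD. Qed.

Definition tone : T := ttensor_of (fun s => (s == [::])%:R).

Definition tmul a b : T := ttensor_of (fun s =>
  \sum_(k < (size s).+1) tcoef a (take k s) * tcoef b (drop k s)).

Let tcoef_tmul a b s : (size s <= m)%N -> tcoef (tmul a b) s =
  \sum_(k < (size s).+1) tcoef a (take k s) * tcoef b (drop k s).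
Proof. exact: tcoef_of. Qed.

Let size_take_le s k : (size s <= m)%N -> (size (take k s) <= m)%N.
Proof. by apply: leq_trans; rewrite size_take_min geq_minr. Qed.

Let size_drop_le s k : (size s <= m)%N -> (size (drop k s) <= m)%N.
Proof. by apply: leq_trans; rewrite size_drop leq_subr. Qed.

Let tmulA : associative tmul.
Proof.
move=> a b c; apply: ttensorP => s sm; rewrite !tcoef_tmul//.
pose f j k := tcoef a (take j s) * tcoef b (take (k - j) (drop j s)) *
              tcoef c (drop k s).
transitivity (\sum_(j < (size s).+1) \sum_(k < (size s).+1 | (j <= k)%N) f j k).
  apply: eq_bigr => j _; have js := ltn_ord j; rewrite ltnS in js.
  rewrite tcoef_tmul ?size_drop_le// mulr_sumr size_drop.
  transitivity (\sum_(j <= k < (size s).+1) f j k).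
    have -> : \sum_(j <= k < (size s).+1) f j k =
              \sum_(0 <= k < (size s).+1 - j) f j (k + j)%N.
      by rewrite -{1}(add0n (j : nat)) big_addn.
    rewrite subSn// big_mkord.
    apply: eq_bigr => k _.
    by rewrite /f addnK drop_drop mulrA.
  by rewrite big_geq_mkord.
rewrite (exchange_big_dep predT)//=; apply: eq_bigr => k _.
have ks := ltn_ord k; rewrite ltnS in ks.
rewrite tcoef_tmul ?size_take_le// mulr_suml size_takel//.
rewrite (big_ord_narrow_leq (F := fun j : 'I_(size s).+1 => f j k) ks).
apply: eq_bigr => j _; rewrite /f /=; have jk := ltn_ord j; rewrite ltnS in jk.
by rewrite take_takel// take_drop subnK.
Qed.

Let tmul1 : left_id tone tmul.
Proof.
move=> a; apply: ttensorP => s sm; rewrite tcoef_tmul// big_ord_recl big1 => [|i _].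
  by rewrite take0 drop0 tcoef_of// mul1r addr0.
rewrite tcoef_of ?size_take_le//; case: s sm i => [|x s] _ i.
  by case: i.
by rewrite /= mul0r.
Qed.

Let tmulr1 : right_id tone tmul.
Proof.
move=> a; apply: ttensorP => s sm; rewrite tcoef_tmul// big_ord_recr big1 => [|i _].
  by rewrite take_size drop_size tcoef_of//= mulr1 add0r.
rewrite tcoef_of ?size_drop_le//= -size_eq0 size_drop subn_eq0 leqNgt ltn_ord.
by rewrite mulr0.
Qed.

Let tmulDl : left_distributive tmul +%R.
Proof.
move=> a b c; apply: ttensorP => s sm; rewrite tcoefD !tcoef_tmul// -big_split.
by apply: eq_bigr => k _ /=; rewrite tcoefD mulrDl.
Qed.

Let tmulDr : right_distributive tmul +%R.
Proof.
move=> a b c; apply: ttensorP => s sm; rewrite tcoefD !tcoef_tmul// -big_split.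
by apply: eq_bigr => k _ /=; rewrite tcoefD mulrDr.
Qed.

Let tone_neq0 : tone != 0.
Proof.
apply/eqP => /(congr1 (tcoef^~ [::])); rewrite tcoef_of// tcoef0 eqxx.
by move/eqP; rewrite oner_eq0.
Qed.

HB.instance Definition _ :=
  GRing.Zmodule_isNzRing.Build T tmulA tmul1 tmulr1 tmulDl tmulDr tone_neq0.

Lemma tcoef1 s : tcoef 1 s = (s == [::])%:R.
Proof.
have [sm|ms] := leqP (size s) m; first exact: tcoef_of.
by rewrite tcoef_long//; case: s ms.
Qed.

Lemma tcoefM a b s : (size s <= m)%N ->
  tcoef (a * b) s = \sum_(k < (size s).+1) tcoef a (take k s) * tcoef b (drop k s).
Proof. exact: tcoef_tmul. Qed.

Let tscaleAl (k : F) a b : k *: (a * b) = (k *: a) * b.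
Proof.
apply: ttensorP => s sm; rewrite tcoefZ !tcoefM// mulr_sumr.
by apply: eq_bigr => i _; rewrite tcoefZ mulrA.
Qed.

HB.instance Definition _ := GRing.Lmodule_isLalgebra.Build F T tscaleAl.

Let tscaleAr (k : F) a b : k *: (a * b) = a * (k *: b).
Proof.
apply: ttensorP => s sm; rewrite tcoefZ !tcoefM// mulr_sumr.
by apply: eq_bigr => i _; rewrite tcoefZ mulrCA.
Qed.

HB.instance Definition _ := GRing.Lalgebra_isAlgebra.Build F T tscaleAr.

Lemma tcoefM_nil a b : tcoef (a * b) [::] = tcoef a [::] * tcoef b [::].
Proof. by rewrite tcoefM//= big_ord1. Qed.

Lemma tcoefX_small a k s :
  tcoef a [::] = 0 -> (size s < k)%N -> tcoef (a ^+ k) s = 0.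
Proof.
move=> a0; elim: k s => [//|k IH] s; rewrite ltnS => sk.
have [ms|sm] := ltnP m (size s); first by rewrite tcoef_long.
rewrite exprS tcoefM// big1 // => -[[|i] /= ilt] _; first by rewrite take0 a0 mul0r.
rewrite IH ?mulr0// size_drop (leq_trans _ sk)//.
by rewrite ltn_subrL /= (leq_trans _ (ilt : (i < size s)%N)).
Qed.

Lemma texpr_nilp a : tcoef a [::] = 0 -> a ^+ m.+1 = 0.
Proof. by move=> a0; apply: ttensorP => s sm; rewrite tcoefX_small ?tcoef0. Qed.

Definition tunit : pred T := fun a => tcoef a [::] != 0.

(* Neumann series *)
Definition tinv a : T :=
  let k := (tcoef a [::])^-1 in
  if tunit a then k *: \sum_(n < m.+1) (1 - k *: a) ^+ n else a.

Let tinv_neumann a : tunit a -> tinv a * a = 1 /\ a * tinv a = 1.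
Proof.
move=> ua; rewrite /tinv ua; set k := _^-1; set x := 1 - k *: a.
have ax : k *: a = 1 - x by rewrite opprB addrC subrK.
have x0 : tcoef x [::] = 0.
  by rewrite tcoefD tcoefN tcoefZ tcoef1 eqxx mulVf// subrr.
have comx (y : T) : y * x = x * y -> y * (1 - x) = (1 - x) * y.
  by move=> yx; rewrite mulrBr mulrBl mulr1 mul1r yx.
set y := \sum_(_ < _) _.
have xy : (1 - x) * y = 1.
  by rewrite -opprB mulNr -subrX1 texpr_nilp// sub0r opprK.
have yx : y * (1 - x) = 1.
  rewrite comx// /y mulr_suml mulr_sumr.
  by apply: eq_bigr => i _; rewrite -exprSr -exprS.
by rewrite -scalerAl scalerAr ax yx -scalerAr scalerAl ax xy.
Qed.

Let tmulVr : {in tunit, left_inverse 1 tinv *%R}.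
Proof. by move=> a /tinv_neumann[]. Qed.

Let tmulrV : {in tunit, right_inverse 1 tinv *%R}.
Proof. by move=> a /tinv_neumann[]. Qed.

Let tunitP a b : b * a = 1 /\ a * b = 1 -> tunit a.
Proof.
move=> [_ ab]; rewrite /tunit; apply/eqP => a0.
move/(congr1 (tcoef^~ [::])): ab; rewrite tcoefM_nil a0 mul0r tcoef1 eqxx.
by move/eqP; rewrite eq_sym oner_eq0.
Qed.

Let tinv_out : {in [predC tunit], tinv =1 id}.
Proof. by move=> a; rewrite inE /tinv => /negbTE ua; rewrite [tunit a]ua. Qed.

HB.instance Definition _ :=
  GRing.NzRing_hasMulInverse.Build T tmulVr tmulrV tunitP tinv_out.

Lemma tunitE a : (a \is a GRing.unit) = (tcoef a [::] != 0).
Proof. by []. Qed.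

(* the inclusion of V as the component of degree 1 *)
Definition tvec (v : V) : T := ttensor_of (fun s =>
  if s is [:: i] then coord (vbasis {:V}) i v else 0).

Lemma tcoef_prod_tvec (vs : seq V) s : (size s <= m)%N ->
  tcoef (\prod_(v <- vs) tvec v) s =
  if size s == size vs
  then \prod_(iv <- zip s vs) coord (vbasis {:V}) iv.1 iv.2 else 0.
Proof.
elim: vs s => [|v vs IH] s sm.
  by rewrite big_nil tcoef1; case: s sm => [|i s] _ //=; rewrite big_nil.
rewrite big_cons tcoefM//; set P := \prod_(_ <- vs) _ in IH *.
case: s sm => [|i s] sm.
  by rewrite big_ord1 /= tcoef_of ?mul0r.
rewrite big_ord_recl big_ord_recl big1 => [|k _].
  rewrite take0 drop0 tcoef_of// mul0r add0r addr0 /= take0 drop0 eqSS.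
  rewrite tcoef_of ?(leq_trans _ sm)// IH ?(ltnW sm)// big_cons.
  by case: ifP; rewrite ?mulr0.
rewrite tcoef_of ?size_take_le//; case: s sm k => [|j s] sm k; first by case: k.
by rewrite /= mul0r.
Qed.

Definition tbracket a b : T := a * b - b * a.

Definition free_lie : set T := [set a | forall L : {vspace T},
  (forall v, tvec v \in L) ->
  (forall b c, b \in L -> c \in L -> tbracket b c \in L) -> a \in L].

(* Only used on tensors without scalar component, where the exponential series
   stops at degree m. *)
Definition texp a : T := \sum_(n < m.+1) (n`!%:R^-1 : F) *: a ^+ n.

Definition tdil (t : F) a : T := ttensor_of (fun s => t ^+ size s * tcoef a s).

End TruncatedTensorAlgebra.

Definition free_group (F : fieldType) (V : vectType F) (m : nat) :
  set (ttensor V m) := texp @` free_lie.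
Arguments free_group {F} V m _.

Section PVariation.
Context {R : realType} {V : normedVectType R} {m : nat}.
Local Notation T := (ttensor V m).
Local Notation G := (free_group V m).

(* The values of N outside of [free_group V m] are irrelevant. *)
Record homogeneous_norm (N : T -> R) : Prop := HomogeneousNorm {
  hnorm_ge0 : forall g, G g -> 0 <= N g;
  hnorm_eq0 : forall g, G g -> N g = 0 <-> g = 1;
  hnorm_dil : forall (t : R) g, G g -> N (tdil t g) = `|t| * N g;
  hnormM : forall g h, G g -> G h -> N (g * h) <= N g + N h;
  hnormV : forall g, G g -> N g^-1 = N g }.

Definition hdist (N : T -> R) (g h : T) : R := N (g^-1 * h).

(* Paths are represented by functions on R considered up to equality on [0, 1].
   Continuity is with respect to the topology of the finite-dimensional vector
   space T^(m)(V), that is, coordinatewise. *)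
Definition group_path : set (R -> T) := [set x : R -> T |
  [/\ forall t : R, t \in `[0, 1] -> G (x t),
      forall s, {within `[0, 1]%classic, continuous (fun t : R => tcoef (x t) s : R)}
    & x 0 = 1]].

Definition incr (x : R -> T) (s t : R) : T := (x s)^-1 * x t.

(* The partition t_0 = 0 < t_1 < ... < t_n = 1 is given as the sequence
   [:: t_1; ...; t_n]. *)
Definition pvar_sum (N : T -> R) (p : R) (x y : R -> T) (D : seq R) : R :=
  let t := nth 1 (0 :: D) in
  \sum_(i < size D)
    hdist N (incr x (t i) (t i.+1)) (incr y (t i) (t i.+1)) `^ p.

Definition pvar_dist (N : T -> R) (p : R) (x y : R -> T) : \bar R :=
  ereal_sup [set (pvar_sum N p x y D `^ p^-1)%:E | D in itv_partition 0 1].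

Definition pvar_space (N : T -> R) (p : R) : set (R -> T) :=
  group_path `&` [set x | (pvar_dist N p x (cst 1%R) < +oo)%E].

End PVariation.

(* [d] is a finite metric on [S], points of [S] being identified along [E] *)
Record metric_on (R : realType) (X : Type) (S : set X) (E : X -> X -> Prop)
    (d : X -> X -> \bar R) : Prop := MetricOn {
  metric_fin : forall x y, S x -> S y -> d x y \is a fin_num;
  metric_ge0 : forall x y, S x -> S y -> (0 <= d x y)%E;
  metric_eq0 : forall x y, S x -> S y -> d x y = 0%E <-> E x y;
  metric_sym : forall x y, S x -> S y -> d x y = d y x;
  metric_triangle : forall x y z, S x -> S y -> S z ->
    (d x z <= d x y + d y z)%E }.

Definition cauchy_seq (R : realType) (X : Type) (d : X -> X -> \bar R)
    (u : nat -> X) : Prop :=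
  forall e : R, 0 < e -> exists N : nat, forall i j : nat,
    (N <= i)%N -> (N <= j)%N -> (d (u i) (u j) < e%:E)%E.

Definition complete_on (R : realType) (X : Type) (S : set X)
    (d : X -> X -> \bar R) : Prop :=
  forall u : nat -> X, (forall n, S (u n)) -> cauchy_seq d u ->
    exists2 x, S x & d (u n) x @[n --> \oo] --> (0 : \bar R).

(* Main.v *)
From HB Require Import structures.
Require Import Defs.
From mathcomp Require Import all_boot all_order all_algebra.
From mathcomp Require Import all_classical all_reals all_analysis.
From mathcomp Require Import ring lra.
Import Order.TTheory GRing.Theory Num.Theory.
Import numFieldNormedType.Exports.
Local Open Scope classical_set_scope.
Local Open Scope ring_scope.

(* Let D be the derivation of T^(m)(V) multiplying degree n by n.  A tensor g
   with scalar component 1 lies in the group exp(Lie) iff its logarithmic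
   derivative g^-1 (D g) is a Lie element; this condition is visibly stable under
   products and limits.  The norm N is continuous: an element close to 1 is a
   product of exponentials of small homogeneous Lie elements, whose norms are
   given by homogeneity.  Conversely, by compactness of the unit sphere of a
   homogeneous gauge, N dominates the coordinates.  Hence (G, d_m) is complete and
   d_m induces the topology of coordinatewise convergence, so that a
   d_(p-var)-Cauchy sequence has a pointwise, in fact d_m-uniform, limit; the
   p-variation sums pass to this limit by continuity of N. *)

(** The definitions leave two things open. The set G is given only as an image under exp, so
    stability under products would ordinarily require the Baker-Campbell-Hausdorff formula; the
    logarithmic derivative replaces it by membership in the vector space L, and in characteristic 0
    the factor n in degree n can be divided out, which recovers a logarithm degree by degree. The
    norm N is subject to algebraic axioms only, so its continuity has to be proved before
    compactness can be used to bound coordinates by N. Compactness enters through ultrafilters: a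
    bounded family of tensors converges coordinatewise along every ultrafilter, and for a Cauchy
    sequence this limit is the limit of the whole sequence. *)

(** A subspace of largest dimension among those contained in P exhausts P, since adding the line of
    a missing element would enlarge it. This gives the Lie algebra, defined as an intersection,
    bases and a projection. *)
Lemma vspace_of_pred (F : fieldType) (U : vectType F) (P : set U) :
  P 0 -> (forall k a b, P a -> P b -> P (k *: a + b)) ->
  exists W : {vspace U}, forall a, a \in W <-> P a.
Proof.
move=> P0 PD.
pose Q n := `[< exists W : {vspace U}, \dim W = n /\ forall a, a \in W -> P a >].
have Q0 : exists n, Q n.
  exists 0%N; apply/asboolP; exists 0%VS; split; first exact: dimv0.
  by move=> a; rewrite memv0 => /eqP ->.
have Qb n : Q n -> (n <= \dim {:U})%N.
  by move=> /asboolP[W [<- _]]; apply/dimvS/subvf.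
case: (ex_maxnP Q0 Qb) => n /asboolP[W [dW WP]] nmax.
exists W => a; split=> [/WP//|Pa].
have : Q (\dim (W + <[a]>)).
  apply/asboolP; exists (W + <[a]>)%VS; split=> // b /memv_addP[w wW [_ /vlineP[k ->]]] ->.
  by rewrite addrC; apply: PD => //; exact: WP.
move=> /nmax; rewrite -dW => dle.
have /eqP -> : W == (W + <[a]>)%VS by rewrite eqEdim addvSl.
by apply: (subvP (addvSr _ _)); exact: memv_line.
Qed.

(** * Grading of the truncated tensor algebra *)

Section Grading.
Context {F : fieldType} {V : vectType F} {m : nat}.
Local Notation T := (ttensor V m).
Implicit Types (a b c e : T) (s : seq 'I_(\dim {:V})) (k : nat).

Lemma tcoefMlong a b s : tcoef (a * b) s =
  if (size s <= m)%N
  then \sum_(k < (size s).+1) tcoef a (take k s) * tcoef b (drop k s) else 0.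
Proof. by case: leqP => sm; [exact: tcoefM|exact: tcoef_long]. Qed.

Definition tproj k a : T :=
  ttensor_of (fun s => if size s == k then tcoef a s else 0).

Definition tdeg a : T := ttensor_of (fun s => (size s)%:R * tcoef a s).

(** Membership in the ideal of tensors of order at least k. Orders add under products, and order
    [m.+1] forces zero, which ends the inductions on degree. *)
Definition tord k a := forall s, (size s < k)%N -> tcoef a s = 0.

Lemma tcoef_proj k a s : tcoef (tproj k a) s = if size s == k then tcoef a s else 0.
Proof.
have [sm|ms] := leqP (size s) m; first by rewrite tcoef_of.
by rewrite !tcoef_long//; case: ifP.
Qed.

Lemma tcoef_deg a s : tcoef (tdeg a) s = (size s)%:R * tcoef a s.
Proof.
have [sm|ms] := leqP (size s) m; first by rewrite tcoef_of.
by rewrite !tcoef_long// mulr0.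
Qed.

Lemma tcoef_dil t a s : tcoef (tdil t a) s = t ^+ size s * tcoef a s.
Proof.
have [sm|ms] := leqP (size s) m; first by rewrite tcoef_of.
by rewrite !tcoef_long// mulr0.
Qed.

Lemma tcoefP a b : (forall s, tcoef a s = tcoef b s) -> a = b.
Proof. by move=> ab; apply: ttensorP => s _. Qed.

Lemma tproj_is_linear k : linear (tproj k).
Proof.
move=> x a b; apply: tcoefP => s; rewrite tcoefD tcoefZ !tcoef_proj.
by case: ifP => _; rewrite ?tcoefD ?tcoefZ// mulr0 addr0.
Qed.
HB.instance Definition _ k :=
  GRing.isLinear.Build F T T _ (tproj k) (tproj_is_linear k).

Lemma tdeg_is_linear : linear tdeg.
Proof.
move=> x a b; apply: tcoefP => s; rewrite tcoefD tcoefZ !tcoef_deg tcoefD tcoefZ.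
by rewrite mulrDr mulrCA.
Qed.
HB.instance Definition _ := GRing.isLinear.Build F T T _ tdeg tdeg_is_linear.

Lemma tdil_is_linear t : linear (@tdil F V m t).
Proof.
move=> x a b; apply: tcoefP => s; rewrite tcoefD tcoefZ !tcoef_dil tcoefD tcoefZ.
by rewrite mulrDr mulrCA.
Qed.
HB.instance Definition _ t :=
  GRing.isLinear.Build F T T _ (@tdil F V m t) (tdil_is_linear t).

Lemma tdil1 t : tdil t 1 = 1 :> T.
Proof.
apply: tcoefP => s; rewrite tcoef_dil !tcoef1; case: eqP => [->|_].
  by rewrite expr0 mul1r.
by rewrite mulr0.
Qed.

Lemma tdilM t a b : tdil t (a * b) = tdil t a * tdil t b.
Proof.
apply: ttensorP => s sm; rewrite tcoef_dil !tcoefM// mulr_sumr.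
apply: eq_bigr => i _; rewrite !tcoef_dil mulrACA -exprD -size_cat cat_take_drop.
by rewrite mulrA.
Qed.

Lemma tdilX t a n : tdil t (a ^+ n) = tdil t a ^+ n.
Proof. by elim: n => [|n IH]; rewrite ?expr0 ?tdil1// !exprS tdilM IH. Qed.

Lemma tdil_exp t a : tdil t (texp a) = texp (tdil t a).
Proof.
by rewrite /texp linear_sum; apply: eq_bigr => i _; rewrite linearZ/= tdilX.
Qed.

Lemma tdegM a b : tdeg (a * b) = tdeg a * b + a * tdeg b.
Proof.
apply: ttensorP => s sm; rewrite tcoefD tcoef_deg !tcoefM// mulr_sumr -big_split.
apply: eq_bigr => i _ /=; rewrite !tcoef_deg.
rewrite -{1}(cat_take_drop i s) size_cat natrD; ring.
Qed.

Lemma tdeg1 : tdeg 1 = 0 :> T.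
Proof.
by apply: tcoefP => s; rewrite tcoef_deg tcoef0 tcoef1; case: s => [|x s]; rewrite ?mul0r ?mulr0.
Qed.

Lemma tdegV a : a \is a GRing.unit -> tdeg a^-1 = - (a^-1 * tdeg a * a^-1).
Proof.
move=> ua; apply: (mulrI ua); rewrite mulrN !mulrA divrr// mul1r.
apply/eqP; rewrite -addr_eq0 addrC -tdegM divrr// tdeg1//.
Qed.

Lemma tproj_sum a : a = \sum_(k < m.+1) tproj k a.
Proof.
apply: ttensorP => s sm; rewrite tcoef_sum.
rewrite (bigD1 (Ordinal (sm : size s < m.+1)%N))//= tcoef_proj eqxx big1 ?addr0// => i.
by rewrite tcoef_proj -val_eqE/= eq_sym => /negbTE ->.
Qed.

Lemma tprojM k a b :
  tproj k (a * b) = \sum_(i < k.+1) tproj i a * tproj (k - i) b.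
Proof.
apply: ttensorP => s sm; rewrite tcoef_proj tcoef_sum tcoefM//.
under [RHS]eq_bigr => i _ do rewrite tcoefM//.
rewrite exchange_big/=.
case: eqP => [<-|/eqP sk].
  apply: eq_bigr => j _.
  rewrite (bigD1 j)//= !tcoef_proj size_takel -1?ltnS// size_drop !eqxx.
  rewrite big1 ?addr0// => i; rewrite -val_eqE/= => ij.
  by rewrite !tcoef_proj size_takel -1?ltnS// eq_sym (negbTE ij) mul0r.
rewrite big1// => j _; rewrite big1// => i _.
rewrite !tcoef_proj; case: eqP => [ti|_]; last by rewrite mul0r.
case: eqP => [di|_]; last by rewrite mulr0.
by move: sk; rewrite -{1}(cat_take_drop j s) size_cat ti di subnKC ?eqxx// -ltnS.
Qed.

Lemma tproj_deg k a : tproj k (tdeg a) = k%:R *: tproj k a.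
Proof.
apply: tcoefP => s; rewrite tcoefZ !tcoef_proj tcoef_deg.
by case: eqP => [->|]; rewrite ?mulr0.
Qed.

Lemma tdeg_proj k a : tdeg (tproj k a) = k%:R *: tproj k a.
Proof.
apply: tcoefP => s; rewrite tcoefZ tcoef_deg !tcoef_proj.
by case: eqP => [->|]; rewrite ?mulr0.
Qed.

Lemma tdil_proj t k a : tdil t (tproj k a) = t ^+ k *: tproj k a.
Proof.
apply: tcoefP => s; rewrite tcoefZ tcoef_dil !tcoef_proj.
by case: eqP => [->|]; rewrite ?mulr0.
Qed.

Lemma tproj0 a : tproj 0 a = (tcoef a [::])%:A.
Proof.
apply: tcoefP => s; rewrite tcoefZ tcoef_proj tcoef1.
by case: s => [|x s]; rewrite ?mulr1 ?mulr0.
Qed.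

Lemma tproj_proj k l a : tproj k (tproj l a) = if k == l then tproj l a else 0.
Proof.
apply: tcoefP => s; rewrite !tcoef_proj.
have [->|kl] := eqVneq k l; first by rewrite ?eqxx tcoef_proj; case: (size s == l).
by rewrite tcoef0; case: eqP => // ->; rewrite (negbTE kl).
Qed.

Lemma tord0 k : tord k 0. Proof. by move=> s _; rewrite tcoef0. Qed.

Lemma tord_nil a : tcoef a [::] = 0 -> tord 1 a.
Proof. by move=> a0 [|x s]. Qed.

Lemma tordW k l a : (k <= l)%N -> tord l a -> tord k a.
Proof. by move=> kl la s sk; apply/la/(leq_trans sk). Qed.

Lemma tordD k a b : tord k a -> tord k b -> tord k (a + b).
Proof. by move=> ka kb s sk; rewrite tcoefD ka// kb// addr0. Qed.

Lemma tordZ k x a : tord k a -> tord k (x *: a).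
Proof. by move=> ka s sk; rewrite tcoefZ ka// mulr0. Qed.

Lemma tordN k a : tord k a -> tord k (- a).
Proof. by move=> ka s sk; rewrite tcoefN ka// oppr0. Qed.

Lemma tord_sum k (I : Type) (r : seq I) (P : pred I) (f : I -> T) :
  (forall i, P i -> tord k (f i)) -> tord k (\sum_(i <- r | P i) f i).
Proof.
by move=> kf; elim/big_ind: _ => //; [exact: tord0|move=> *; exact: tordD].
Qed.

Lemma tordM k l a b : tord k a -> tord l b -> tord (k + l) (a * b).
Proof.
move=> ka lb s skl; rewrite tcoefMlong; case: ifP => // _.
rewrite big1// => i _; have [ik|ki] := ltnP (size (take i s)) k.
  by rewrite ka// mul0r.
rewrite lb ?mulr0//.
have sz : (size (take i s) + size (drop i s) = size s)%N.
  by rewrite -size_cat cat_take_drop.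
by rewrite -(ltn_add2l k) (leq_ltn_trans _ skl)// (leq_trans _ (eq_leq sz))// leq_add2r.
Qed.

Lemma tordMl k a b : tord k b -> tord k (a * b).
Proof. by move=> kb; rewrite -(add0n k); apply: tordM => // s. Qed.

Lemma tordMr k a b : tord k a -> tord k (a * b).
Proof. by move=> ka; rewrite -(addn0 k); apply: tordM => // s. Qed.

Lemma tord_eq0 k a : (m < k)%N -> tord k a -> a = 0.
Proof.
by move=> mk ka; apply: ttensorP => s sm; rewrite ka ?tcoef0//; exact: leq_ltn_trans mk.
Qed.

Lemma tord_proj k a : tord k (tproj k a).
Proof. by move=> s sk; rewrite tcoef_proj ltn_eqF. Qed.

Lemma tord_projS k a : tord k a -> tord k.+1 (a - tproj k a).
Proof.
move=> ka s; rewrite ltnS tcoefD tcoefN tcoef_proj leq_eqVlt => /orP[->|sk].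
  by rewrite subrr.
by rewrite ka// ltn_eqF// subrr.
Qed.

Lemma tordS_proj k a : tord k.+1 a -> tproj k a = 0.
Proof.
move=> ka; apply: tcoefP => s; rewrite tcoef_proj tcoef0; case: eqP => // sk.
by rewrite ka// sk.
Qed.

Lemma tordX a k : tcoef a [::] = 0 -> tord k (a ^+ k).
Proof. by move=> a0 s; exact: tcoefX_small. Qed.

End Grading.

(** Cauchy product: the terms dropped from the square lie beyond its antidiagonal, and vanish by
    nilpotency when exponentials are multiplied. *)
Lemma sum_triangle (W : nmodType) (M : nat) (f : nat -> nat -> W) :
  (forall i j, (M <= i + j)%N -> f i j = 0) ->
  \sum_(i < M) \sum_(j < M) f i j = \sum_(n < M) \sum_(i < n.+1) f i (n - i)%N.
Proof.
move=> f0.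
transitivity (\sum_(i < M) \sum_(n < M | (i <= n)%N) f i (n - i)%N).
  apply: eq_bigr => i _.
  rewrite -(big_mkord predT (f i)) (@big_cat_nat _ _ _ (M - i))//= ?leq_subr//.
  have -> : \sum_(M - i <= j < M) f i j = 0.
    by rewrite big_nat; apply: big1 => j; rewrite leq_subLR => /andP[/f0].
  transitivity (\sum_(i <= n < M) f i (n - i)%N); last by rewrite big_geq_mkord.
  rewrite addr0 -[X in index_iota X M]add0n big_addn.
  by apply: eq_bigr => j _; rewrite addnK.
rewrite (exchange_big_dep predT)//=; apply: eq_bigr => n _.
have nM := ltn_ord n.
by rewrite (big_ord_narrow (F := fun i : 'I_M => f i (n - i)%N) nM).
Qed.

(** * Free nilpotent Lie algebra and logarithmic derivatives *)

Section FreeLie.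
Context {F : numFieldType} {V : vectType F} {m : nat}.
Local Notation T := (ttensor V m).
Local Notation L := (@free_lie F V m).
Implicit Types (a b c e g h y : T) (k n : nat).

(** The definition of [free_lie] quantifies over subspaces; closure of P under linear combinations
    turns P into one. *)
Lemma free_lie_ind (P : set T) : P 0 ->
  (forall x a b, P a -> P b -> P (x *: a + b)) -> (forall v, P (tvec v)) ->
  (forall a b, P a -> P b -> P (a * b - b * a)) -> L `<=` P.
Proof.
move=> P0 PD Pv Pb a La; have [W WP] := vspace_of_pred _ _ P P0 PD.
by apply/WP/La => [v|b c /WP ? /WP ?]; apply/WP => //; exact: Pb.
Qed.

Lemma free_lie_vec v : L (tvec v). Proof. by move=> W Wv _. Qed.

Lemma free_lie0 : L 0. Proof. by move=> W _ _; exact: mem0v. Qed.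

Lemma free_lieP (x : F) a b : L a -> L b -> L (x *: a + b).
Proof.
by move=> La Lb W Wv Wb; apply: memvD; [apply/memvZ/La|exact: Lb].
Qed.

Lemma free_lieZ (x : F) a : L a -> L (x *: a).
Proof. by move=> La; rewrite -[_ *: _]addr0; apply/free_lieP/free_lie0. Qed.

Lemma free_lieD a b : L a -> L b -> L (a + b).
Proof. by move=> La Lb; have := free_lieP 1 _ _ La Lb; rewrite scale1r. Qed.

Lemma free_lieN a : L a -> L (- a).
Proof. by move=> La; rewrite -scaleN1r; exact: free_lieZ. Qed.

Lemma free_lie_bracket a b : L a -> L b -> L (a * b - b * a).
Proof. by move=> La Lb W Wv Wb; apply: (Wb); [exact: La|exact: Lb]. Qed.

Lemma free_lie_sum (I : Type) (r : seq I) (P : pred I) (f : I -> T) :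
  (forall i, P i -> L (f i)) -> L (\sum_(i <- r | P i) f i).
Proof.
move=> Lf; elim/big_ind: _ => //; first exact: free_lie0.
by move=> *; exact: free_lieD.
Qed.

Lemma free_lie_vspace : exists W : {vspace T}, forall a, a \in W <-> L a.
Proof. by apply: vspace_of_pred; [exact: free_lie0|exact: free_lieP]. Qed.

Lemma free_lie_nil a : L a -> tcoef a [::] = 0.
Proof.
move: a; apply: free_lie_ind => [|k a b a0 b0|v|a b a0 b0].
- exact: tcoef0.
- by rewrite tcoefD tcoefZ a0 b0 mulr0 addr0.
- by rewrite tcoef_of.
- by rewrite tcoefD tcoefN !tcoefM_nil a0 b0 mulr0 subrr.
Qed.

Lemma tproj_bracket k a b : tproj k (a * b - b * a) =
  \sum_(i < k.+1) (tproj i a * tproj (k - i) b - tproj (k - i) b * tproj i a).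
Proof.
rewrite linearB/= !tprojM sumrB; congr (_ - _).
rewrite [LHS](reindex_inj rev_ord_inj)/=; apply: eq_bigr => i _.
by rewrite subSS subKn// -ltnS.
Qed.

(** The generators are homogeneous of degree 1, and a component of a bracket is a sum of brackets of
    components; the induction therefore treats all k at once. *)
Lemma free_lie_proj k a : L a -> L (tproj k a).
Proof.
move=> La; move: a La k.
apply: (@free_lie_ind (fun a => forall k, L (tproj k a))) => [k|x a b La Lb k|v k|a b La Lb k].
- by rewrite linear0; exact: free_lie0.
- by rewrite linearP; apply: free_lieP; [exact: La|exact: Lb].
- suff -> : tproj k (tvec v) = if k == 1 then tvec v else 0 :> T.
    by case: ifP => _; [exact: free_lie_vec|exact: free_lie0].
  apply: ttensorP => s sm; rewrite tcoef_proj.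
  have vs : size s != 1 -> tcoef (tvec v : T) s = 0.
    by rewrite tcoef_of//; case: s {sm} => [|x [|y s]].
  have [->|k1] := eqVneq k 1.
    by have [//|/vs ->] := eqVneq (size s) 1.
  by rewrite tcoef0; case: eqP => // sk; rewrite vs// sk.
- by rewrite tproj_bracket; apply: free_lie_sum => i _; apply: free_lie_bracket; [exact: La|exact: Lb].
Qed.

Lemma free_lie_dil t a : L a -> L (tdil t a).
Proof.
move=> La; rewrite (tproj_sum a) linear_sum; apply: free_lie_sum => i _.
by rewrite /= tdil_proj; exact/free_lieZ/free_lie_proj.
Qed.

Lemma free_lie_deg a : L a -> L (tdeg a).
Proof.
move=> La; rewrite (tproj_sum a) linear_sum; apply: free_lie_sum => i _ /=.
by rewrite tdeg_proj; exact/free_lieZ/free_lie_proj.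
Qed.

Lemma tunip g : tcoef g [::] = 1 -> g \is a GRing.unit.
Proof. by move=> g1; rewrite tunitE g1 oner_eq0. Qed.

Lemma tcoefV_nil g : tcoef g [::] = 1 -> tcoef g^-1 [::] = 1.
Proof.
move=> g1; have := congr1 (tcoef^~ [::]) (mulVr (tunip _ g1)).
by rewrite tcoefM_nil g1 mulr1 tcoef1.
Qed.

Lemma tord_sub1 g : tcoef g [::] = 1 -> tord 1 (g - 1).
Proof. by move=> g1; apply: tord_nil; rewrite tcoefD tcoefN tcoef1 g1 subrr. Qed.

Lemma tproj_unipl k g y : tcoef g [::] = 1 -> tord k y ->
  tproj k (g * y) = tproj k y.
Proof.
move=> g1 ky; rewrite -[g](subrK 1) mulrDl mul1r linearD/= tordS_proj ?add0r//.
by rewrite -add1n; apply: tordM => //; exact: tord_sub1.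
Qed.

Lemma tproj_unipr k g y : tcoef g [::] = 1 -> tord k y ->
  tproj k (y * g) = tproj k y.
Proof.
move=> g1 ky; rewrite -[g](subrK 1) mulrDr mulr1 linearD/= tordS_proj ?add0r//.
by rewrite -addn1; apply: tordM => //; exact: tord_sub1.
Qed.

(* With D the derivation [tdeg], the exponential of a Lie series g is
   recognised by its logarithmic derivative g^-1 (D g). *)
Definition lie_logderiv g := tcoef g [::] = 1 /\ L (g^-1 * tdeg g).

(* For y of degree k, w = h^-1 y h satisfies D w = k w + [w, x] where
   x = h^-1 (D h) has no component of degree 0: the component of w of degree
   j <> k is a sum of brackets of lower ones with components of x. *)
Lemma free_lie_conj_proj k h y : lie_logderiv h -> L y ->
  L (h^-1 * tproj k y * h).
Proof.
move=> [h1 Lx] /(free_lie_proj k) Ly; set x := h^-1 * tdeg h in Lx.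
set z := tproj k y in Ly *; set w := h^-1 * z * h.
have uh := tunip _ h1.
have Dw : tdeg w = k%:R *: w + (w * x - x * w).
  have Dh : tdeg h = h * x by rewrite mulrA divrr// mul1r.
  rewrite /w !tdegM tdegV// Dh tdeg_proj (mulrA h^-1 h x) mulVr// mul1r.
  rewrite mulrDl -scalerAr -scalerAl !mulNr !mulrA.
  by rewrite [- _ + _]addrC -addrA [- _ + _]addrC.
suff Lw j : L (tproj j w) by rewrite (tproj_sum w); exact: free_lie_sum.
elim/ltn_ind: j => j IH.
have [->|jk] := eqVneq j k.
  (* In degree k the equation for D w says nothing, but z has order k, and factors with constant
     term 1 do not change a lowest component. *)
  have kz : tord k z by exact: tord_proj.
  rewrite tproj_unipr ?tproj_unipl//; first by rewrite tproj_proj eqxx.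
    exact: tcoefV_nil.
  exact: tordMl.
have jk0 : j%:R - k%:R != 0 :> F by rewrite subr_eq0 eqr_nat.
have := congr1 (tproj j) Dw; rewrite tproj_deg linearD linearZ/= tproj_bracket.
move/eqP; rewrite addrC -subr_eq -scalerBl big_ord_recr/= subnn.
rewrite tproj0 free_lie_nil// scale0r mulr0 mul0r subrr addr0 => /eqP e.
rewrite -[tproj j w]scale1r -(mulVf jk0) -scalerA e; apply/free_lieZ/free_lie_sum.
by move=> i _; apply: free_lie_bracket; [exact: IH|exact: free_lie_proj].
Qed.

Lemma free_lie_conj h y : lie_logderiv h -> L y -> L (h^-1 * y * h).
Proof.
move=> Gh Ly; rewrite (tproj_sum y) mulr_sumr mulr_suml.
by apply: free_lie_sum => i _; exact: free_lie_conj_proj.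
Qed.

(** The identity is (g h)^-1 D(g h) = h^-1 (g^-1 D g) h + h^-1 D h, and conjugation by h preserves
    L. *)
Lemma lie_logderivM g h : lie_logderiv g -> lie_logderiv h -> lie_logderiv (g * h).
Proof.
move=> [g1 Lg] Gh; have [h1 Lh] := Gh; have [ug uh] := (tunip _ g1, tunip _ h1).
split; first by rewrite tcoefM_nil g1 h1 mulr1.
rewrite tdegM invrM// mulrDr !mulrA -(mulrA h^-1 g^-1 g) mulVr// mulr1.
by apply: free_lieD => //; rewrite -(mulrA _ g^-1); exact: free_lie_conj.
Qed.

End FreeLie.

(** * Exponentials and the free nilpotent group *)

Section Exponential.
Context {F : numFieldType} {V : vectType F} {m : nat}.
Local Notation T := (ttensor V m).
Local Notation L := (@free_lie F V m).
Local Notation G := (@free_group F V m).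
Implicit Types (a b c e g h y : T) (k n : nat).

Lemma invfact_bin i n : (i <= n)%N ->
  i`!%:R^-1 * (n - i)`!%:R^-1 = n`!%:R^-1 * 'C(n, i)%:R :> F.
Proof.
move=> le_in; rewrite -(bin_fact le_in) !natrM !invfM mulrAC mulVf ?mul1r//.
by rewrite pnatr_eq0 -lt0n bin_gt0.
Qed.

Lemma tpow_eq0 a n : tcoef a [::] = 0 -> (m < n)%N -> a ^+ n = 0.
Proof. by move=> a0 mn; apply: (tord_eq0 n) => //; exact: tordX. Qed.

Lemma texp0 : texp 0 = 1 :> T.
Proof.
rewrite /texp big_ord_recl big1 => [|i _]; last by rewrite expr0n scaler0.
by rewrite addr0 expr0 fact0 invr1 scale1r.
Qed.

(** In the Cauchy product the terms of total degree n sum to (a - a)^n / n!, because a and -a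
    commute. *)
Lemma texpN a : tcoef a [::] = 0 -> texp (- a) * texp a = 1.
Proof.
move=> a0; rewrite /texp mulr_suml; under eq_bigr do rewrite mulr_sumr.
pose f i j := (i`!%:R^-1 *: (- a) ^+ i) * (j`!%:R^-1 *: a ^+ j) : T.
have fE i j : f i j = (i`!%:R^-1 * j`!%:R^-1) *: ((- a) ^+ i * a ^+ j).
  by rewrite /f -scalerAl -scalerAr scalerA.
rewrite (sum_triangle _ m.+1 f) => [|i j ij]; last first.
  by rewrite fE exprNn -[_ * a ^+ j]mulrA -exprD tpow_eq0// mulr0 scaler0.
transitivity (\sum_(n < m.+1) (n`!%:R^-1 : F) *: (0 : T) ^+ n); last exact: texp0.
apply: eq_bigr => n _; rewrite -[X in _ = _ *: (X ^+ _)](subrr a) exprDn_comm; last exact/commrN.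
rewrite scaler_sumr; apply: eq_bigr => i _.
rewrite fE invfact_bin -1?ltnS// -scalerA scaler_nat.
by congr (_ *: (_ *+ _)); apply/commrX/commr_sym/commrX/commrN.
Qed.

(** Right bracketing b |-> [b, a], that is -ad a; this sign avoids alternating signs in the formulas
    for D(a^n) and D(exp a). *)
Definition adr a b : T := b * a - a * b.

(** With y_k the k-th iterate of [adr a] on D a, each new factor a on the right is moved to the left
    by y_k a = a y_k + y_(k+1); the coefficients then combine by Pascal's rule. *)
Lemma tdegX a n : tdeg (a ^+ n.+1) =
  \sum_(k < n.+1) 'C(n.+1, k.+1)%:R *: (a ^+ (n - k) * iter k (adr a) (tdeg a)).
Proof.
elim: n => [|n IH]; first by rewrite big_ord1 expr1 subnn expr0 mul1r scale1r.
pose y k := iter k (adr a) (tdeg a).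
rewrite exprSr tdegM IH mulr_suml.
have yS k : y k * a = y k.+1 + a * y k by rewrite /y/= /adr subrK.
transitivity (\sum_(k < n.+1) 'C(n.+1, k.+1)%:R *: (a ^+ (n.+1 - k) * y k) +
   \sum_(k < n.+1) 'C(n.+1, k.+1)%:R *: (a ^+ (n - k) * y k.+1) + a ^+ n.+1 * tdeg a).
  congr (_ + _); rewrite -big_split; apply: eq_bigr => k _ /=.
  rewrite -scalerAl -mulrA -/(y k) yS mulrDr scalerDr addrC; congr (_ + _).
  by rewrite mulrA -exprSr -subSn// -ltnS.
under [RHS]eq_bigr => k _ do rewrite binS natrD scalerDl.
rewrite [RHS]big_split/=; rewrite -addrA; congr (_ + _).
  by rewrite [RHS]big_ord_recr/= bin_small// scale0r addr0.
rewrite [RHS]big_ord_recl/= bin0 scale1r subn0 addrC; congr (_ + _).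
Qed.

Lemma tord_deg k a : tord k a -> tord k (tdeg a).
Proof. by move=> ka s sk; rewrite tcoef_deg ka// mulr0. Qed.

(** The sum is the series (exp(adr a) - 1) / adr a applied to D a: the classical derivative of the
    exponential. *)
Lemma tdeg_exp a : tcoef a [::] = 0 -> tdeg (texp a) =
  texp a * \sum_(k < m.+1) k.+1`!%:R^-1 *: iter k (adr a) (tdeg a).
Proof.
move=> a0; pose y k := iter k (adr a) (tdeg a).
have a1 : tord 1 a by exact: tord_nil.
have yord k : tord k.+1 (y k).
  elim: k => [|k IH]; first exact: tord_deg.
  rewrite /y/= /adr -/(y k); apply: tordD; first by rewrite -addn1; exact: tordM.
  by apply: tordN; rewrite -add1n; exact: tordM.
pose f k l := (l`!%:R^-1 *: a ^+ l) * (k.+1`!%:R^-1 *: y k) : T.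
have fE k l : f k l = (k.+1`!%:R^-1 * l`!%:R^-1) *: (a ^+ l * y k).
  by rewrite /f -scalerAl -scalerAr scalerA mulrC.
have f0 k l : (m <= k + l)%N -> f k l = 0.
  move=> mkl; rewrite fE (tord_eq0 (l + k.+1) (a ^+ l * y k)) ?scaler0//.
    by rewrite addnS ltnS addnC.
  by apply: tordM => //; exact: tordX.
rewrite {2}/texp mulr_suml; under [RHS]eq_bigr do rewrite mulr_sumr.
rewrite exchange_big (sum_triangle _ m.+1 f) => [|k l /ltnW/f0//].
(* The top diagonal k + l = m vanishes because y k has order k + 1. On the other side D kills the
   constant term of exp a, so that m terms remain in both sums. *)
rewrite big_ord_recr/= [X in _ + X]big1 ?addr0 => [|k _]; last first.
  by apply: f0; rewrite subnKC// -ltnS.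
rewrite /texp linear_sum big_ord_recl linearZ/= expr0 tdeg1 scaler0 add0r.
apply: eq_bigr => n _; rewrite linearZ/= tdegX scaler_sumr.
apply: eq_bigr => k _; rewrite fE scalerA -(subSS k n) invfact_bin//.
Qed.

Lemma lie_logderiv_exp a : L a -> lie_logderiv (texp a).
Proof.
move=> La; have a0 := free_lie_nil _ La.
have e1 : tcoef (texp a) [::] = 1.
  rewrite tcoef_sum big_ord_recl big1 => [|i _].
    by rewrite tcoefZ expr0 tcoef1 eqxx mulr1 fact0 invr1 addr0.
  by rewrite tcoefZ tcoefX_small ?mulr0.
split=> //; rewrite tdeg_exp// mulrA mulVr ?mul1r; last exact: tunip.
apply: free_lie_sum => k _; apply: free_lieZ; elim: (k : nat) => [|n IH] /=.
  exact: free_lie_deg.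
by apply: free_lie_bracket; [exact: IH|exact: La].
Qed.

(** For n >= 2, every term of (a + e)^n - a^n contains e together with a further factor of order at
    least 1, so only the linear term of the series contributes in degree k. *)
Lemma texpD_ord k a e : tcoef a [::] = 0 -> (0 < k)%N -> tord k e ->
  tord k.+1 (texp (a + e) - texp a - e).
Proof.
move=> a0 k0 ke; have e1 : tord 1 e by exact: tordW ke.
have a1 : tord 1 a by exact: tord_nil.
have ae1 : tord 1 (a + e) by exact: tordD.
have pow n : tord k.+1 ((a + e) ^+ n.+2 - a ^+ n.+2).
  elim: n => [|n IH].
    rewrite !expr2 mulrDr mulrDl addrAC [_ + e * a]addrC addrK.
    by apply: tordD; [rewrite -addn1|rewrite -add1n]; exact: tordM.
  rewrite exprS (exprS a); set P := (a + e) ^+ _ in IH *; set Q := a ^+ _ in IH *.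
  have -> : (a + e) * P - a * Q = (a + e) * (P - Q) + e * Q.
    by rewrite mulrBr [(a + e) * Q]mulrDl opprD addrA subrK.
  apply: tordD; first exact: tordMl.
  by rewrite -addn1; apply: tordM => //; apply: (@tordW _ _ _ _ n.+2) => //; exact: tordX.
(* For m = 0 the series has no linear term to isolate, but then e = 0. *)
have [m0|m0] := posnP m.
  have -> : e = 0 by apply: (tord_eq0 1) => //; rewrite m0.
  by rewrite addr0 subrr subr0; exact: tord0.
rewrite /texp -sumrB (bigD1 (Ordinal (m0 : 1 < m.+1)%N))//=.
rewrite !expr1 invr1 !scale1r [a + e]addrC addrK [e + _]addrC addrK.
apply: tord_sum => -[[|[|n]]//= nm _]; rewrite -scalerBr; apply: tordZ.
  by rewrite !expr0 subrr; exact: tord0.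
by rewrite [e + a]addrC; exact: pow.
Qed.

Lemma free_group_nil g : G g -> tcoef g [::] = 1.
Proof. by case=> a La <-; case: (lie_logderiv_exp _ La). Qed.

(** In the lowest degree of g - 1, multiplication by g^-1 has no effect and D acts as the factor
    [k.+1], which is invertible in characteristic 0. *)
Lemma free_lie_proj_logderiv k g : lie_logderiv g -> tord k.+1 (g - 1) ->
  L (tproj k.+1 g).
Proof.
move=> [g1 Lg] kg.
have gE : tproj k.+1 (g^-1 * tdeg g) = k.+1%:R *: tproj k.+1 g.
  rewrite tproj_unipl ?tproj_deg//; first exact: tcoefV_nil.
  by rewrite -[tdeg g]subr0 -tdeg1 -linearB; exact: tord_deg.
have k0 : k.+1%:R != 0 :> F by rewrite pnatr_eq0.
by rewrite -[tproj k.+1 g]scale1r -(mulVf k0) -scalerA -gE; exact/free_lieZ/free_lie_proj.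
Qed.

(** For the converse a logarithm is corrected degree by degree: if g agrees with exp a up to degree
    k, then exp(-a) g still meets the criterion and equals 1 + e + higher terms with e Lie of degree
    k + 1, and a + e is right up to degree k + 1. *)
Lemma free_groupP g : G g <-> lie_logderiv g.
Proof.
split=> [[a La <-]|Gg]; first exact: lie_logderiv_exp.
have [g1 Lg] := Gg.
suff approx k : exists2 a, L a & tord k.+1 (g - texp a).
  have [a La /tord_eq0 ga] := approx m; exists a => //.
  by apply/esym/eqP; rewrite -subr_eq0 ga.
elim: k => [|k [a La ga]].
  by exists 0; [exact: free_lie0|rewrite texp0; exact: tord_sub1].
have a0 := free_lie_nil _ La.
have [ea1 _] := lie_logderiv_exp _ La.
pose r := texp (- a) * g; pose e := tproj k.+1 r.
have Gr : lie_logderiv r by apply: lie_logderivM => //; exact/lie_logderiv_exp/free_lieN.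
have exp1 : texp a * texp (- a) = 1.
  by rewrite -{1}(opprK a) texpN// tcoefN a0 oppr0.
have gE : g = texp a * r by rewrite mulrA exp1 mul1r.
have rord : tord k.+1 (r - 1).
  rewrite -(texpN a a0) -mulrBr; exact: tordMl.
have proj1 : tproj k.+1 1 = 0 :> T.
  by apply: tcoefP => -[|i s]; rewrite tcoef_proj tcoef1 tcoef0//; case: ifP.
have eord : tord k.+1 e by exact: tord_proj.
have Le : L e by exact: free_lie_proj_logderiv.
exists (a + e); first exact: free_lieD.
(* The three terms have order k + 2: the nonlinearity of exp, a product of two deviations from 1,
   and the remainder of r past its lowest term. *)
have -> : g - texp (a + e) =
    - (texp (a + e) - texp a - e) + ((texp a - 1) * (r - 1) + (r - 1 - e)).
  rewrite [X in _ = _ + X]addrA mulrBl mul1r subrK mulrBr mulr1 -gE !opprB.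
  by rewrite [RHS]addrC (addrA _ e) subrK addrA subrK.
apply: tordD; first by apply/tordN/texpD_ord.
apply: tordD; first by rewrite -add1n; apply: tordM => //; exact: tord_sub1.
have -> : e = tproj k.+1 (r - 1) by rewrite linearB/= proj1 subr0.
exact: tord_projS.
Qed.

Lemma free_group1 : G 1.
Proof. by exists 0; [exact: free_lie0|exact: texp0]. Qed.

Lemma free_groupM g h : G g -> G h -> G (g * h).
Proof. by rewrite !free_groupP; exact: lie_logderivM. Qed.

Lemma free_groupV g : G g -> G g^-1.
Proof.
move=> Gg; have ug := tunip _ (free_group_nil _ Gg); case: Gg => a La ga.
exists (- a); first exact: free_lieN.
by apply: (mulIr ug); rewrite mulVr// -ga texpN// free_lie_nil.
Qed.

Lemma free_groupVM g h : G g -> G h -> G (g^-1 * h).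
Proof. by move=> Gg Gh; apply: free_groupM => //; exact: free_groupV. Qed.

Lemma free_group_unit g : G g -> g \is a GRing.unit.
Proof. by move=> /free_group_nil/tunip. Qed.

Lemma free_group_dil t g : G g -> G (tdil t g).
Proof.
by case=> a La <-; exists (tdil t a); [exact: free_lie_dil|rewrite tdil_exp].
Qed.

End Exponential.

(** * Coordinatewise convergence *)

Lemma cvgr_unique {R : realType} {I : Type} {F : set_system I} {FF : ProperFilter F}
  (f : I -> R) (x y : R) : f @ F --> x -> f @ F --> y -> x = y.
Proof. by move=> fx fy; rewrite -(cvg_lim (@Rhausdorff R) fx) -(cvg_lim (@Rhausdorff R) fy). Qed.

Lemma cvgr_sum {R : realType} {I J : Type} {F : set_system I} {FF : Filter F}
    (r : seq J) (P : pred J) (f : J -> I -> R) (l : J -> R) :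
  (forall j, P j -> f j @ F --> l j) ->
  \sum_(j <- r | P j) f j i @[i --> F] --> \sum_(j <- r | P j) l j.
Proof.
move=> fl; elim: r => [|j r IH].
  by under eq_fun do rewrite big_nil; rewrite big_nil; exact: cvg_cst.
under eq_fun do rewrite big_cons; rewrite big_cons; case: ifP => // Pj.
by apply: cvgD => //; exact: fl.
Qed.

Section TensorConvergence.
Context {R : realType} {V : vectType R} {m : nat}.
Local Notation T := (ttensor V m).
Local Notation L := (@free_lie R V m).
Local Notation G := (@free_group R V m).
Context {I : Type} {F : set_system I} {FF : Filter F}.
Implicit Types (a b c : T) (u v : I -> T).

(** The filter is arbitrary: the notion is used along [\oo], along ultrafilters and along
    neighbourhoods within [0, 1]. *)
Definition tcvg u a := forall s, (tcoef (u i) s : R) @[i --> F] --> (tcoef a s : R).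

Lemma tcvg_cst a : tcvg (fun=> a) a.
Proof. by move=> s; exact: cvg_cst. Qed.

Lemma tcvgD u v a b : tcvg u a -> tcvg v b -> tcvg (fun i => u i + v i) (a + b).
Proof.
by move=> ua vb s; under eq_fun do rewrite tcoefD; rewrite tcoefD; apply: cvgD.
Qed.

Lemma tcvgZ (k : I -> R) (l : R) u a : k @ F --> l -> tcvg u a ->
  tcvg (fun i => k i *: u i) (l *: a).
Proof.
by move=> kl ua s; under eq_fun do rewrite tcoefZ; rewrite tcoefZ; apply: cvgM.
Qed.

Lemma tcvgN u a : tcvg u a -> tcvg (fun i => - u i) (- a).
Proof.
by move=> ua s; under eq_fun do rewrite tcoefN; rewrite tcoefN; apply: cvgN.
Qed.

Lemma tcvgB u v a b : tcvg u a -> tcvg v b -> tcvg (fun i => u i - v i) (a - b).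
Proof. by move=> ua vb; apply/tcvgD/tcvgN. Qed.

Lemma tcvgM u v a b : tcvg u a -> tcvg v b -> tcvg (fun i => u i * v i) (a * b).
Proof.
move=> ua vb s; under eq_fun do rewrite tcoefMlong; rewrite tcoefMlong.
case: ifP => _; last exact: cvg_cst.
by apply: cvgr_sum => k _; apply: cvgM; [exact: ua|exact: vb].
Qed.

Lemma tcvg_sum (J : Type) (r : seq J) (f : J -> I -> T) (l : J -> T) :
  (forall j, tcvg (f j) (l j)) ->
  tcvg (fun i => \sum_(j <- r) f j i) (\sum_(j <- r) l j).
Proof.
move=> fl s; under eq_fun do rewrite tcoef_sum; rewrite tcoef_sum.
by apply: cvgr_sum => j _; exact: fl.
Qed.

Lemma tcvg_prod (J : Type) (r : seq J) (f : J -> I -> T) (l : J -> T) :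
  (forall j, tcvg (f j) (l j)) ->
  tcvg (fun i => \prod_(j <- r) f j i) (\prod_(j <- r) l j).
Proof.
move=> fl; elim: r => [|j r IH].
  by under eq_fun do rewrite big_nil; rewrite big_nil; exact: tcvg_cst.
by under eq_fun do rewrite big_cons; rewrite big_cons; exact: tcvgM.
Qed.

Lemma tcvgX n u a : tcvg u a -> tcvg (fun i => u i ^+ n) (a ^+ n).
Proof.
move=> ua; elim: n => [|n IH].
  by under eq_fun do rewrite expr0; rewrite expr0; exact: tcvg_cst.
by under eq_fun do rewrite exprS; rewrite exprS; exact: tcvgM.
Qed.

Lemma tcvg_exp u a : tcvg u a -> tcvg (fun i => texp (u i)) (texp a).
Proof. by move=> ua; apply: tcvg_sum => n; apply: tcvgZ; [exact: cvg_cst|exact: tcvgX]. Qed.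

Lemma tcvg_deg u a : tcvg u a -> tcvg (fun i => tdeg (u i)) (tdeg a).
Proof.
move=> ua s; under eq_fun do rewrite tcoef_deg; rewrite tcoef_deg.
by apply: cvgM; [exact: cvg_cst|exact: ua].
Qed.

(** With constant term 1 the Neumann series is a fixed polynomial, so inversion is continuous. *)
Lemma tinv_series a : tcoef a [::] = 1 -> a^-1 = \sum_(n < m.+1) (1 - a) ^+ n.
Proof.
move=> a1; apply: (mulIr (tunip _ a1)); rewrite mulVr ?tunip//.
have x0 : tcoef (1 - a) [::] = 0 by rewrite tcoefD tcoefN tcoef1 a1 subrr.
have -> : a = 1 - (1 - a) by rewrite subKr.
move: (1 - a) x0 => x x0; rewrite subKr.
have comx n : x ^+ n * (1 - x) = (1 - x) * x ^+ n.
  by rewrite mulrBl mulrBr mul1r mulr1 -exprS -exprSr.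
rewrite mulr_suml; under eq_bigr do rewrite comx.
by rewrite -mulr_sumr -opprB mulNr -subrX1 texpr_nilp// sub0r opprK.
Qed.

Lemma tcvgV u a : (forall i, tcoef (u i) [::] = 1) -> tcoef a [::] = 1 ->
  tcvg u a -> tcvg (fun i => (u i)^-1) a^-1.
Proof.
move=> u1 a1 ua; under eq_fun do rewrite tinv_series//.
rewrite tinv_series//; apply: tcvg_sum => n; apply: tcvgX.
by apply: tcvgB => //; exact: tcvg_cst.
Qed.

Lemma tcoef_basis a :
  a = \sum_(w : m.-bseq 'I_(\dim {:V})) tcoef a w *: ttensor_of (fun s => (s == w)%:R).
Proof.
apply: ttensorP => s sm; rewrite tcoef_sum.
rewrite (bigD1 (Bseq sm))//= tcoefZ tcoef_of// eqxx mulr1 big1 ?addr0// => w.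
by rewrite -val_eqE/= eq_sym tcoefZ tcoef_of// => /negbTE ->; rewrite mulr0.
Qed.

Lemma tcvg_scalar (f : T -> R) u a :
  (forall x b c, f (x *: b + c) = x * f b + f c) -> tcvg u a ->
  f (u i) @[i --> F] --> f a.
Proof.
move=> fl ua; pose e (w : m.-bseq 'I_(\dim {:V})) : T := ttensor_of (fun s => (s == w)%:R).
have f0 : f 0 = 0.
  by have /eqP := fl 1 0 0; rewrite scale1r addr0 mul1r -subr_eq subrr => /eqP.
have fE b : f b = \sum_(w : m.-bseq 'I_(\dim {:V})) tcoef b w * f (e w).
  rewrite {1}[b]tcoef_basis.
  by elim/big_rec2: _ => [|w x y _ <-]; [exact: f0|rewrite fl].
rewrite fE; under eq_fun do rewrite fE; apply: cvgr_sum => w _.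
by apply: cvgM; [exact: ua|exact: cvg_cst].
Qed.

End TensorConvergence.
Arguments tcvg {R V m I} F u a.

(** * Closedness of the free Lie algebra and of the group *)

Section FreeGroupClosed.
Context {R : realType} {V : vectType R} {m : nat}.
Local Notation T := (ttensor V m).
Local Notation L := (@free_lie R V m).
Local Notation G := (@free_group R V m).
Context {I : Type} {F : set_system I} {FF : ProperFilter F}.
Implicit Types (a : T) (u : I -> T).

Lemma tcvg_unique u a b : tcvg F u a -> tcvg F u b -> a = b.
Proof. by move=> ua ub; apply: tcoefP => s; exact: cvgr_unique (ua s) (ub s). Qed.

(** L is a subspace W, hence the kernel of 1 - [projv W], whose coordinates are linear and therefore
    continuous. *)
Lemma free_lie_closed u a : (forall i, L (u i)) -> tcvg F u a -> L a.
Proof.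
move=> Lu ua; have [W WP] := @free_lie_vspace R V m.
have Wu i : u i \in W by apply/WP.
suff /WP : a \in W by [].
have : a - projv W a = 0.
  apply: tcoefP => s; rewrite tcoef0.
  pose f (b : T) : R := tcoef (b - projv W b) s.
  have fa : f (u i) @[i --> F] --> f a.
    apply: tcvg_scalar => // x b c.
    rewrite /f linearP/= opprD addrACA -scalerBr.
    by rewrite [LHS]tcoefD tcoefZ.
  apply: (cvgr_unique _ _ _ fa).
  have -> : (fun i => f (u i)) = fun=> 0.
    by apply/funext => i; rewrite /f projv_id// subrr tcoef0.
  exact: cvg_cst.
by move/eqP; rewrite subr_eq0 => /eqP ->; exact: memv_proj.
Qed.

Lemma free_group_closed u a : (forall i, G (u i)) -> tcvg F u a -> G a.
Proof.
move=> Gu ua; have u1 i := free_group_nil _ (Gu i).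
have a1 : tcoef a [::] = 1.
  apply: (cvgr_unique _ _ _ (ua [::])); rewrite (_ : (fun _ => _) = fun=> 1).
    exact: cvg_cst.
  by apply/funext => i.
apply/free_groupP; split=> //.
apply: (free_lie_closed (fun i => (u i)^-1 * tdeg (u i))) => [i|].
  by have /free_groupP[] := Gu i.
by apply: tcvgM; [exact: tcvgV|exact: tcvg_deg].
Qed.

End FreeGroupClosed.

(** Differentiability settles a positive limit only; at 0, the bound e on f^r is obtained from the
    bound e^(1/r) on f. *)
Lemma powR_cvg {R : realType} {I : Type} {F : set_system I} {FF : Filter F}
    (f : I -> R) (l r : R) : 0 < r -> (forall i, 0 <= f i) -> 0 <= l ->
  f @ F --> l -> (f i `^ r) @[i --> F] --> l `^ r.
Proof.
move=> r0 f0 l0 fl; have [l00|/eqP l00] := eqVneq l 0.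
  rewrite l00 powR0 ?gt_eqF//; apply/cvgr0Pnorm_lt => e e0.
  have er0 : 0 < e `^ r^-1 by rewrite powR_gt0.
  move: fl; rewrite l00 => /cvgr0Pnorm_lt/(_ _ er0).
  apply: filterS => i; rewrite !ger0_norm ?powR_ge0// => fe.
  have -> : e = (e `^ r^-1) `^ r by rewrite -powRrM mulVf ?gt_eqF// powRr1// ltW.
  by apply: gt0_ltr_powR => //; rewrite nnegrE ?powR_ge0.
have lp : 0 < l by rewrite lt_neqAle eq_sym l0 andbT; apply/eqP.
have : {for l, continuous (@powR R ^~ r)}.
  apply/differentiable_continuous/derivable1_diffP/derivable_powR.
  by rewrite in_itv/= lp.
move=> /(cvg_comp _ _ fl); exact.
Qed.

(** In a compact interval an ultrafilter clusters at some point, and it converges there since it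
    contains each neighbourhood or its complement. *)
Lemma ultra_cvgr {R : realType} {I : Type} (F : set_system I) {UF : UltraFilter F}
    (f : I -> R) (B : R) : (forall i, `|f i| <= B) -> exists l : R, f @ F --> l.
Proof.
move=> fB; have [|l [_ lF]] := @segment_compact R (- B) B (fmap f F) _.
  by apply: nearW => i /=; rewrite in_itv/= -ler_norml.
exists l => A Al; have [//|FA] := in_ultra_setVsetC (f @^-1` A) UF.
have : (f @ F) (~` A) by [].
by move=> /lF/(_ Al)[x []].
Qed.

(** A single ultrafilter serves all coordinates at once, in place of successive extractions of
    subsequences. *)
Lemma ultra_tcvg {R : realType} {V : vectType R} {m : nat} {I : Type}
    (F : set_system I) {UF : UltraFilter F} (u : I -> ttensor V m) (B : R) :
  (forall i s, `|tcoef (u i) s| <= B) -> exists a, tcvg F u a.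
Proof.
move=> uB.
have /boolp.choice[l ul] : forall s, exists l : R, tcoef (u i) s @[i --> F] --> l.
  by move=> s; apply: (ultra_cvgr F _ B) => i; exact: uB.
exists (ttensor_of l) => s; have [sm|ms] := leqP (size s) m; first by rewrite tcoef_of.
rewrite tcoef_long// (_ : (fun i => tcoef (u i) s) = fun=> 0); first exact: cvg_cst.
by apply/funext => i; exact: tcoef_long.
Qed.

(** * Continuity of homogeneous norms *)

Section HomogeneousNorm.
Context {R : realType} {V : normedVectType R} {m : nat}.
Local Notation T := (ttensor V m).
Local Notation L := (@free_lie R V m).
Local Notation G := (@free_group R V m).
Context (N : T -> R) (N_norm : homogeneous_norm N).
Implicit Types (a b g h : T) (k n : nat).

Lemma hnorm1 : N 1 = 0.
Proof. by apply/(hnorm_eq0 N_norm free_group1). Qed.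

Lemma hnorm_prod (J : Type) (r : seq J) (f : J -> T) : (forall j, G (f j)) ->
  G (\prod_(j <- r) f j) /\ N (\prod_(j <- r) f j) <= \sum_(j <- r) N (f j).
Proof.
move=> Gf; elim: r => [|j r [Gr Nr]].
  by rewrite !big_nil hnorm1; split=> //; exact: free_group1.
rewrite !big_cons; split; first exact: free_groupM.
by apply: (le_trans (hnormM N_norm (Gf j) Gr)); rewrite lerD2l.
Qed.

(** For t >= 0, exp (t b) is the dilation of exp b by t^(1/k). A negative c is reached through exp
    (c b) = exp (-c b)^-1, since dilations cannot change the sign of b when k is even. *)
Lemma hnorm_exp k b (c : R) : (0 < k)%N -> L b -> tproj k b = b ->
  N (texp (c *: b)) = `|c| `^ k%:R^-1 * N (texp b).
Proof.
move=> k0 Lb bk; have Gb : G (texp b) by exists b.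
have pos (t : R) : 0 <= t -> N (texp (t *: b)) = t `^ k%:R^-1 * N (texp b).
  move=> t0; rewrite -[in RHS](ger0_norm (powR_ge0 t k%:R^-1)) -(hnorm_dil N_norm)//.
  rewrite tdil_exp -[in RHS]bk tdil_proj bk -powR_mulrn ?powR_ge0// -powRrM.
  by rewrite mulVf ?powRr1// pnatr_eq0 -lt0n.
have [c0|/ltW c0] := leP 0 c; first by rewrite pos// ger0_norm.
rewrite ler0_norm// -pos ?oppr_ge0//.
have Lc : L (- c *: b) by exact: free_lieZ.
have Gc : G (texp (- c *: b)) by exists (- c *: b).
rewrite -(hnormV N_norm Gc); congr N.
apply: (mulIr (free_group_unit _ Gc)); rewrite mulVr ?free_group_unit//.
by rewrite -{1}[c]opprK scaleNr texpN// free_lie_nil.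
Qed.

(** A product of two deviations from 1, each of order k >= 1, has order at least k + 1. The
    induction also carries the order of the sum, which bounds that of w - 1. *)
Lemma tord_prod_exp k (J : Type) (r : seq J) (f : J -> T) : (0 < k)%N ->
  (forall j, tord k (f j)) ->
  tord k.+1 (\prod_(j <- r) texp (f j) - 1 - \sum_(j <- r) f j).
Proof.
move=> k0 kf; pose K (w x : T) := tord k x /\ tord k.+1 (w - 1 - x).
suff [] : K (\prod_(j <- r) texp (f j)) (\sum_(j <- r) f j) by [].
apply: big_rec2 => [|j w x _ [kx kw]].
  by split; [exact: tord0|rewrite subrr subr0; exact: tord0].
split; first exact: tordD.
have kexp : tord k.+1 (texp (f j) - 1 - f j).
  by have := texpD_ord k 0 (f j) (tcoef0 _) k0 (kf j); rewrite add0r texp0.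
have kw1 : tord k (w - 1).
  by rewrite -[w - 1](subrK x); apply: tordD => //; exact: (tordW _ _ _ (leqnSn k) kw).
have -> : texp (f j) * w - 1 - (f j + x) =
    (texp (f j) - 1 - f j) * w + (f j * (w - 1) + (w - 1 - x)).
  rewrite (mulrBl w (texp _ - 1)) (mulrBl w (texp _)) mul1r mulrBr mulr1.
  rewrite [RHS]addrA [X in _ = X + _]addrA subrK.
  rewrite [X in _ = X + _]addrAC [RHS]addrA [X in _ = X + _]addrA subrK.
  by rewrite [X in _ = X + _]addrAC opprD addrA.
apply: tordD; first exact: tordMr.
by apply: tordD => //; rewrite -addn1; apply: tordM => //; exact: (tordW _ _ _ k0 kw1).
Qed.

(* Downward induction on the order k of u i - 1: the components of degree k of
   the u i lie in L and are the sum of the x_j = c_j(i) b_j, for (b_j) a basis of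
   the Lie elements of degree k; dividing u i by the product of the exp x_j
   raises the order, while N (exp x_j) = |c_j(i)|^(1/k) N (exp b_j) by
   homogeneity. *)
Lemma hnorm_cvg1_ord (I : Type) (F : set_system I) {FF : Filter F} k (u : I -> T) :
  (0 < k)%N -> (forall i, G (u i)) -> (forall i, tord k (u i - 1)) ->
  tcvg F u 1 -> N (u i) @[i --> F] --> 0.
Proof.
have [n] := ubnP (m.+1 - k); elim: n k u => // n IH [//|k] u nk _ Gu ku u1.
have [mk|km] := leqP m.+1 k.+1.
  rewrite (_ : (fun i => N (u i)) = fun=> 0); first exact: cvg_cst.
  by apply/funext => i; move/eqP: (tord_eq0 _ _ mk (ku i)); rewrite subr_eq0 => /eqP ->; exact: hnorm1.
have [W WP] : exists W : {vspace T}, forall a, a \in W <-> (L a /\ tproj k.+1 a = a).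
  apply: vspace_of_pred => [|x a b [La ak] [Lb bk]].
    by split; [exact: free_lie0|rewrite linear0].
  by split; [exact: free_lieP|rewrite linearP/= ak bk].
pose b := vbasis W; pose c j a : R := coord b j (tproj k.+1 a).
(* Past the end of the basis the default value 0 satisfies both claims as well. *)
have bW j : L b`_j /\ tproj k.+1 b`_j = b`_j.
  have [jb|bj] := ltnP j (size b); first by apply/WP/vbasis_mem/mem_nth.
  by rewrite nth_default//; split; [exact: free_lie0|rewrite linear0].
pose x i j := c j (u i) *: b`_j.
have proj1 : tproj k.+1 1 = 0 :> T.
  by apply: tcoefP => -[|y s]; rewrite tcoef_proj tcoef1 tcoef0//; case: ifP.
have xE i : \sum_(j < \dim W) x i j = tproj k.+1 (u i).
  rewrite [RHS](coord_vbasis (U := W))//; apply/WP; split; last by rewrite tproj_proj eqxx.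
  by apply: free_lie_proj_logderiv => //; exact/free_groupP.
have c0 j : c j (u i) @[i --> F] --> 0.
  have -> : 0 = c j 1 by rewrite /c proj1 linear0.
  by apply: tcvg_scalar => // y a1 a2; rewrite /c !linearP.
have Lx i j : L (x i j) by apply: free_lieZ; case: (bW j).
have xord i j : tord k.+1 (x i j).
  by case: (bW j) => _ bj; rewrite /x -bj; apply/tordZ/tord_proj.
have Gx i j : G (texp (x i j)) by exists (x i j).
pose w i := \prod_(j < \dim W) texp (x i j).
have Gw i : G (w i) by case: (hnorm_prod _ (index_enum _) (fun j => texp (x i j)) (Gx i)).
have uw i : w i \is a GRing.unit by exact: free_group_unit.
have Nw i : N (w i) <= \sum_(j < \dim W) N (texp (x i j)).
  by case: (hnorm_prod _ (index_enum _) (fun j => texp (x i j)) (Gx i)).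
have w1 : tcvg F w 1.
  rewrite (_ : 1 = \prod_(j < \dim W) (1 : T)); last by rewrite big1.
  apply: tcvg_prod => j; rewrite -texp0; apply: tcvg_exp.
  by rewrite -(scale0r b`_j); apply: tcvgZ => //; exact: tcvg_cst.
pose v i := (w i)^-1 * u i.
have Gv i : G (v i) by apply: free_groupM => //; exact: free_groupV.
have Nv : N (v i) @[i --> F] --> 0.
  apply: (IH k.+2) => //.
  - by rewrite subSS subnS prednK ?subn_gt0//; move: nk; rewrite subSS.
  (* Up to degree k + 1 both u and w reduce to 1 plus the sum of the x_j, so w^-1 u - 1 = w^-1 (u -
     w) has order k + 2. *)
  - move=> i; rewrite -(mulVr (uw i)) -mulrBr; apply: tordMl.
    have -> : u i - w i = (u i - 1 - tproj k.+1 (u i)) - (w i - 1 - \sum_(j < \dim W) x i j).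
      by rewrite xE opprB addrA subrK opprB addrA subrK.
    apply: tordD; last by apply/tordN/tord_prod_exp.
    have -> : tproj k.+1 (u i) = tproj k.+1 (u i - 1) by rewrite linearB/= proj1 subr0.
    exact: tord_projS.
  - rewrite -[1](mulVr (unitr1 T)); apply: tcvgM => //.
    by apply: tcvgV => //; [move=> i; exact: free_group_nil|rewrite tcoef1].
have Nsum : \sum_(j < \dim W) N (texp (x i j)) + N (v i) @[i --> F] --> 0.
  rewrite -[X in _ --> X]addr0; apply: cvgD => //.
  have zeroE : \sum_(j < \dim W) 0 * N (texp b`_j) = 0.
    by rewrite big1// => j _; rewrite mul0r.
  rewrite -[X in _ --> X]zeroE; apply: cvgr_sum => j _; have [Lb bk] := bW j.
  under eq_fun do rewrite (hnorm_exp k.+1)//.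
  apply: cvgM; last exact: cvg_cst.
  have -> : 0 = 0 `^ k.+1%:R^-1 :> R by rewrite powR0// invr_eq0 pnatr_eq0.
  by apply: powR_cvg => //; rewrite -[X in _ --> X](normr0 R); exact: cvg_norm.
apply: (squeeze_cvgr _ (cvg_cst 0) Nsum); apply: nearW => i.
rewrite (hnorm_ge0 N_norm)//= -[u i]mul1r -(divrr (uw i)) -mulrA.
by apply: (le_trans (hnormM N_norm (Gw i) (Gv i))); rewrite lerD2r.
Qed.

Lemma hnorm_cvg1 (I : Type) (F : set_system I) {FF : Filter F} (u : I -> T) :
  (forall i, G (u i)) -> tcvg F u 1 -> N (u i) @[i --> F] --> 0.
Proof.
move=> Gu; apply: (hnorm_cvg1_ord I F 1) => // i.
exact/tord_sub1/free_group_nil.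
Qed.

Lemma hnorm_distr g h : G g -> G h -> `|N h - N g| <= N (g^-1 * h).
Proof.
move=> Gg Gh; have GV g' h' : G g' -> G h' -> G (g'^-1 * h').
  by move=> ? ?; apply: free_groupM => //; exact: free_groupV.
have tri g' h' : G g' -> G h' -> N h' - N g' <= N (g'^-1 * h').
  move=> Gg' Gh'; rewrite lerBlDl -[h' in leLHS]mul1r.
  rewrite -(divrr (free_group_unit _ Gg')) -mulrA.
  by apply: hnormM => //; exact: GV.
rewrite ler_norml lerNl opprB tri// andbT.
rewrite -(hnormV N_norm (GV _ _ Gg Gh)) invrM ?unitrV ?free_group_unit//.
by rewrite invrK tri.
Qed.

Lemma hnorm_cvg (I : Type) (F : set_system I) {FF : Filter F} (u : I -> T) a :
  (forall i, G (u i)) -> G a -> tcvg F u a -> N (u i) @[i --> F] --> N a.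
Proof.
move=> Gu Ga ua; have GV := free_groupV _ Ga.
have a1 := free_group_nil _ Ga.
have : N (a^-1 * u i) @[i --> F] --> 0.
  apply: hnorm_cvg1 => [i|]; first exact: free_groupM.
  rewrite -[1](mulVr (free_group_unit _ Ga)); apply: tcvgM => //; exact: tcvg_cst.
move=> /cvgr0Pnorm_lt Na; apply/cvgrPdist_lt => e /Na; apply: filterS => i.
by rewrite distrC => Ne; apply: le_lt_trans Ne; apply/(le_trans (hnorm_distr _ _ Ga (Gu i)))/ler_norm.
Qed.

(** * A homogeneous gauge in coordinates *)

Definition hweight (w : m.-bseq 'I_(\dim {:V})) : nat := m`! %/ size w.

(* The exponents make [hgauge] homogeneous of degree m! under dilations. *)
Definition hgauge g : R :=
  \sum_(w : m.-bseq 'I_(\dim {:V}) | (0 < size w)%N) `|tcoef g w| ^+ hweight w.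

Lemma hweight_gt0 (w : m.-bseq 'I_(\dim {:V})) : (0 < size w)%N -> (0 < hweight w)%N.
Proof.
move=> w0; rewrite divn_gt0//; apply: dvdn_leq; first exact: fact_gt0.
by apply: dvdn_fact; rewrite w0/= size_bseq.
Qed.

Lemma hgauge_ge0 g : 0 <= hgauge g.
Proof. by apply: sumr_ge0 => w _; exact: exprn_ge0. Qed.

Lemma hgauge_dil t g : hgauge (tdil t g) = `|t| ^+ m`! * hgauge g.
Proof.
rewrite mulr_sumr; apply: eq_bigr => w w0.
(* The division in [hweight] is exact, as 1 <= size w <= m. *)
rewrite tcoef_dil normrM normrX exprMn -exprM mulnC divnK//.
by apply: dvdn_fact; rewrite w0/= size_bseq.
Qed.

Lemma tcoef_hgauge g (w : m.-bseq 'I_(\dim {:V})) : (0 < size w)%N ->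
  `|tcoef g w| ^+ hweight w <= hgauge g.
Proof.
by move=> w0; rewrite /hgauge (bigD1 w)//= lerDl; apply: sumr_ge0 => v _; exact: exprn_ge0.
Qed.

Lemma hgauge1 : hgauge 1 = 0.
Proof.
apply: big1 => w w0; rewrite tcoef1 -size_eq0 gtn_eqF// normr0 expr0n.
by rewrite gtn_eqF// hweight_gt0.
Qed.

Lemma cvgr_exprn (I : Type) (F : set_system I) {FF : Filter F} (f : I -> R) (l : R) n :
  f @ F --> l -> f i ^+ n @[i --> F] --> l ^+ n.
Proof.
move=> fl; elim: n => [|n IH]; first by under eq_fun do rewrite expr0; exact: cvg_cst.
by under eq_fun do rewrite exprS; rewrite exprS; exact: cvgM.
Qed.

Lemma hgauge_cvg (I : Type) (F : set_system I) {FF : Filter F} (u : I -> T) a :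
  tcvg F u a -> hgauge (u i) @[i --> F] --> hgauge a.
Proof.
move=> ua; apply: cvgr_sum => w _; apply: cvgr_exprn.
by apply: cvg_norm; exact: ua.
Qed.

(** The summand 1 covers the constant coordinate and those of absolute value at most 1; a larger one
    is bounded by its power of exponent at least 1. *)
Lemma tcoef_hgauge_le g s : G g -> `|tcoef g s| <= 1 + hgauge g.
Proof.
move=> Gg; have [ms|sm] := ltnP m (size s).
  by rewrite tcoef_long// normr0 addr_ge0// hgauge_ge0.
case: s sm => [|j s] sm; first by rewrite (free_group_nil _ Gg) normr1 lerDl hgauge_ge0.
have [|x1] := leP `|tcoef g (j :: s)| 1; first by move=> /le_trans; apply; rewrite lerDl hgauge_ge0.
rewrite (@le_trans _ _ (hgauge g)) ?lerDr//.
apply: le_trans (tcoef_hgauge g (Bseq sm) _) => //=.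
by rewrite -{1}[`|_|]expr1 ler_weXn2l ?ltW// hweight_gt0.
Qed.

End HomogeneousNorm.

(** * Completeness of the group *)

Section NormGauge.
Context {R : realType} {V : normedVectType R} {m : nat}.
Local Notation T := (ttensor V m).
Local Notation L := (@free_lie R V m).
Local Notation G := (@free_group R V m).
Context (N : T -> R) (N_norm : homogeneous_norm N).
Implicit Types (a b g h : T) (k n : nat).

(** Otherwise N tends to 0 along some sequence of gauge 1. Its limit along an ultrafilter has gauge
    1, lies in G, and satisfies N = 0 by continuity of N; so it is 1, whose gauge is 0. *)
Lemma hnorm_unit_gauge : exists2 c : R, 0 < c & forall g, G g -> hgauge g = 1 -> c <= N g.
Proof.
apply: contrapT => nc.
have /boolp.choice[u uP] : forall n, exists g, [/\ G g, hgauge g = 1 & N g < n.+1%:R^-1].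
  move=> n; apply: contrapT => ng; apply: nc; exists n.+1%:R^-1 => // g Gg g1.
  by rewrite leNgt; apply/negP => Ng; apply: ng; exists g.
have [U [UU sU]] := @ultraFilterLemma nat \oo _.
have [a ua] : exists a, tcvg U u a.
  apply: (ultra_tcvg U u 2) => i s; have [Gu u1 _] := uP i.
  by apply: (le_trans (tcoef_hgauge_le _ s Gu)); rewrite u1.
have Gu i : G (u i) by case: (uP i).
have Ga : G a by exact: free_group_closed ua.
have Na : N a = 0.
  apply: (cvgr_unique _ _ _ (hnorm_cvg _ N_norm _ _ _ _ Gu Ga ua)).
  have N0 : N (u i) @[i --> \oo] --> 0.
    apply: (squeeze_cvgr _ (cvg_cst 0) cvg_harmonic); apply: nearW => i.
    by have [_ _ /ltW ->] := uP i; rewrite (hnorm_ge0 N_norm).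
  by move=> A /N0/sU.
have a1 : a = 1 by apply/(hnorm_eq0 N_norm Ga).
have : hgauge a = 1.
  apply: (cvgr_unique _ _ _ (hgauge_cvg _ _ _ _ ua)).
  rewrite (_ : (fun i => hgauge (u i)) = fun=> 1); first exact: cvg_cst.
  by apply/funext => i; case: (uP i).
by rewrite a1 hgauge1 => /esym/eqP; rewrite oner_eq0.
Qed.

(** Dilation by 1/t, where t^(m!) = [hgauge g], brings g to the unit sphere of the gauge; there N is
    bounded below. *)
Lemma hgauge_le_hnorm : exists2 c : R, 0 < c & forall g, G g -> hgauge g <= c * N g ^+ m`!.
Proof.
have [c c0 cP] := hnorm_unit_gauge.
exists (c^-1 ^+ m`!) => [|g Gg]; first by rewrite exprn_gt0// invr_gt0.
have [g0|/eqP g0] := eqVneq (hgauge g) 0.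
  by rewrite g0 mulr_ge0// exprn_ge0// ?invr_ge0 ?(ltW c0)// (hnorm_ge0 N_norm).
have gp : 0 < hgauge g by rewrite lt_neqAle eq_sym hgauge_ge0 andbT; apply/eqP.
have mf : m`!%:R != 0 :> R by rewrite pnatr_eq0 -lt0n fact_gt0.
pose t := hgauge g `^ (m`!%:R^-1).
have t0 : 0 < t by rewrite powR_gt0.
have tm : t ^+ m`! = hgauge g.
  by rewrite -powR_mulrn ?ltW// -powRrM mulVf// powRr1// ltW.
have := cP _ (free_group_dil t^-1 _ Gg).
have tV0 : 0 <= t^-1 by rewrite invr_ge0 ltW.
rewrite hgauge_dil (hnorm_dil N_norm)// ger0_norm// [t^-1 ^+ _]exprVn tm.
rewrite mulVf ?gt_eqF// => /(_ erefl); rewrite ler_pdivlMl// => tcN.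
rewrite -tm -exprMn lerXn2r// ?nnegrE ?mulr_ge0 ?invr_ge0 ?(ltW c0) ?(ltW t0) ?(hnorm_ge0 N_norm)//.
by rewrite ler_pdivlMl// mulrC.
Qed.

Lemma hnorm_small (I : Type) (F : set_system I) {FF : Filter F} (u : I -> T) :
  (forall i, G (u i)) -> N (u i) @[i --> F] --> 0 -> tcvg F u 1.
Proof.
move=> Gu Nu s; have [c c0 cP] := hgauge_le_hnorm.
have [ms|sm] := ltnP m (size s).
  rewrite tcoef_long// (_ : (fun i => tcoef (u i) s) = fun=> 0); first exact: cvg_cst.
  by apply/funext => i; exact: tcoef_long.
case: s sm => [|j s] sm.
  rewrite tcoef1 (_ : (fun i => tcoef (u i) [::]) = fun=> 1); first exact: cvg_cst.
  by apply/funext => i; rewrite (free_group_nil _ (Gu i)).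
rewrite tcoef1/=; pose w := Bseq sm; have w0 : (0 < hweight w)%N by exact: hweight_gt0.
have gauge0 : c * N (u i) ^+ m`! @[i --> F] --> 0.
  have -> : 0 = c * 0 ^+ m`! :> R by rewrite expr0n gtn_eqF ?fact_gt0// mulr0.
  by apply: cvgM; [exact: cvg_cst|exact: cvgr_exprn].
apply/cvgr0Pnorm_lt => e e0.
have ew : 0 < e ^+ hweight w by exact: exprn_gt0.
move/cvgr0Pnorm_lt : gauge0 => /(_ _ ew); apply: filterS => i ci.
rewrite -(ltr_pXn2r w0) ?nnegrE ?(ltW e0)//.
apply: le_lt_trans (ci); apply: le_trans (ler_norm _).
exact: le_trans (tcoef_hgauge (u i) w _) (cP _ (Gu i)).
Qed.

(** A tail of the sequence, translated to v, satisfies N (v j) < 1, which bounds its coordinates by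
    1 + c and gives an ultrafilter limit. With i fixed, the Cauchy inequality passes to this limit
    in j, whence convergence along the whole sequence. *)
Lemma free_group_hnorm_complete (u : nat -> T) : (forall n, G (u n)) ->
  (forall e, 0 < e -> exists n, forall i j, (n <= i)%N -> (n <= j)%N -> N ((u i)^-1 * u j) < e) ->
  exists2 x, G x & N ((u n)^-1 * x) @[n --> \oo] --> 0.
Proof.
move=> Gu uC; have GV i := free_groupV _ (Gu i).
have [n1 n1P] := uC 1 ltr01; have [c c0 cP] := hgauge_le_hnorm.
have [U [UU sU]] := @ultraFilterLemma nat \oo _.
pose v j := (u n1)^-1 * u (n1 + j)%N.
have Gv j : G (v j) by exact: free_groupM.
have [a va] : exists a, tcvg U v a.
  apply: (ultra_tcvg U v (1 + c)) => j s; apply: (le_trans (tcoef_hgauge_le _ s (Gv j))).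
  rewrite lerD2l (le_trans (cP _ (Gv j)))// ger_pMr// exprn_ile1 ?(hnorm_ge0 N_norm)//.
  by apply: ltW; apply: n1P => //; exact: leq_addr.
have Ga : G a by exact: free_group_closed va.
have Gx : G (u n1 * a) by exact: free_groupM.
exists (u n1 * a) => //.
have ux : tcvg U (fun j => u (n1 + j)%N) (u n1 * a).
  have : tcvg U (fun j => u n1 * v j) (u n1 * a) by apply: tcvgM => //; exact: tcvg_cst.
  by congr tcvg; apply/funext => j; rewrite mulrA divrr ?mul1r// free_group_unit.
apply/cvgr0Pnorm_le => e e0; have [n nP] := uC _ e0.
exists n => // i /= ni; rewrite ger0_norm; last by apply: (hnorm_ge0 N_norm); exact: free_groupM.
have : N ((u i)^-1 * u (n1 + j)%N) @[j --> U] --> N ((u i)^-1 * (u n1 * a)).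
  apply: hnorm_cvg => // [j||]; [exact: free_groupM|exact: free_groupM|].
  by apply: tcvgM => //; exact: tcvg_cst.
move=> /cvgr_to_le; apply; apply: sU; exists n => // j /= nj.
by apply/ltW/nP => //; apply: leq_trans nj _; exact: leq_addl.
Qed.

End NormGauge.

(** * The p-variation metric *)

Lemma convex_powR_line {R : realType} (p l x y : R) : 1 <= p -> 0 <= l -> l <= 1 ->
  0 <= x -> 0 <= y ->
  (l * x + (1 - l) * y) `^ p <= l * x `^ p + (1 - l) * y `^ p.
Proof.
move=> p1 l0 l1 x0 y0.
have := @convex_powR _ p p1 (Itv01 l0 l1) x y.
by rewrite !inE/= !in_itv/= !andbT => /(_ x0 y0); rewrite !convRE.
Qed.

(** With A and B the norms of a and b, a i + b i is A + B times the convex combination of a i / A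
    and b i / B with weights A / (A + B) and B / (A + B); convexity of the p-th power is then summed
    over i. A zero norm makes all its terms zero and is treated apart. *)
Lemma minkowski_sum {R : realType} (p : R) (n : nat) (a b : 'I_n -> R) : 1 <= p ->
  (forall i, 0 <= a i) -> (forall i, 0 <= b i) ->
  (\sum_i (a i + b i) `^ p) `^ p^-1 <=
  (\sum_i a i `^ p) `^ p^-1 + (\sum_i b i `^ p) `^ p^-1.
Proof.
move=> p1 a0 b0; have p0 : 0 < p by exact: lt_le_trans p1.
have pn0 : p != 0 by rewrite gt_eqF.
pose nrm (c : 'I_n -> R) := (\sum_i c i `^ p) `^ p^-1.
have nrm0 (c : 'I_n -> R) : (forall i, 0 <= c i) -> nrm c = 0 -> forall i, c i = 0.
  move=> c0 /powR_eq0_eq0/eqP; rewrite psumr_eq0 => [|i _]; last exact: powR_ge0.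
  by move=> /allP cp i; have /eqP/powR_eq0_eq0 := cp i (mem_index_enum i).
have nrmX (c : 'I_n -> R) : nrm c `^ p = \sum_i c i `^ p.
  by rewrite /nrm -powRrM mulVf// powRr1// sumr_ge0// => i _; exact: powR_ge0.
have nrm1 (c : 'I_n -> R) : (forall i, 0 <= c i) -> 0 < nrm c ->
    \sum_i (c i / nrm c) `^ p = 1.
  move=> c0 cp; under eq_bigr => i _ do rewrite powRM ?invr_ge0 ?(ltW cp)//.
  by rewrite -mulr_suml -nrmX -powRM ?invr_ge0 ?(ltW cp)// divff ?powR1 ?gt_eqF.
have nrm_ge0 c : 0 <= nrm c by exact: powR_ge0.
rewrite -/(nrm a) -/(nrm b) -/(nrm (fun i => a i + b i)).
have [A0|A0] := eqVneq (nrm a) 0.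
  by rewrite A0 add0r /nrm; under eq_bigr => i _ do rewrite (nrm0 _ a0 A0) add0r.
have [B0|B0] := eqVneq (nrm b) 0.
  by rewrite B0 addr0 /nrm; under eq_bigr => i _ do rewrite (nrm0 _ b0 B0) addr0.
have Ap : 0 < nrm a by rewrite lt0r A0 nrm_ge0.
have Bp : 0 < nrm b by rewrite lt0r B0 nrm_ge0.
have nrmab := nrmX (fun i => a i + b i).
have na1 := nrm1 a a0 Ap; have nb1 := nrm1 b b0 Bp.
have nab0 := nrm_ge0 (fun i => a i + b i).
move: (nrm a) (nrm b) (nrm (fun i => a i + b i)) Ap Bp nrmab na1 nb1 nab0.
move=> A B C Ap Bp CE na1 nb1 C0.
have Sp : 0 < A + B by exact: addr_gt0.
rewrite leNgt; apply/negP => /(gt0_ltr_powR p0); rewrite !nnegrE => /(_ (ltW Sp) C0).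
apply/negP; rewrite -leNgt CE.
pose l := A / (A + B).
have l0 : 0 <= l by rewrite divr_ge0// ltW.
have l1 : 1 - l = B / (A + B) by rewrite /l; field; rewrite gt_eqF.
have l1' : l <= 1 by rewrite -subr_ge0 l1 divr_ge0// ltW.
apply: (@le_trans _ _ (\sum_i (A + B) `^ p * (l * (a i / A) `^ p + (1 - l) * (b i / B) `^ p))).
  apply: ler_sum => i _.
  have aA : 0 <= a i / A by rewrite divr_ge0// ltW.
  have bB : 0 <= b i / B by rewrite divr_ge0// ltW.
  have lin0 : 0 <= l * (a i / A) + (1 - l) * (b i / B).
    by rewrite addr_ge0// mulr_ge0// subr_ge0.
  apply: le_trans (ler_wpM2l (powR_ge0 _ _) (convex_powR_line _ _ _ _ p1 l0 l1' aA bB)).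
  rewrite -powRM ?(ltW Sp)//.
  suff -> : (A + B) * (l * (a i / A) + (1 - l) * (b i / B)) = a i + b i by [].
  by rewrite l1 /l; field; rewrite !gt_eqF.
by rewrite -mulr_sumr big_split/= -!mulr_sumr na1 nb1 !mulr1 addrC subrK mulr1.
Qed.

Lemma itv_partition_point {R : realType} (a b : R) s i : itv_partition a b s ->
  (i <= size s)%N -> nth b (a :: s) i \in `[a, b].
Proof.
by move=> abs si; rewrite in_itv/= itv_partition_nth_ge ?itv_partition_nth_le.
Qed.

Section PVariationMetric.
Context {R : realType} {V : normedVectType R} {m : nat}.
Local Notation T := (ttensor V m).
Local Notation G := (@free_group R V m).
Context (N : T -> R) (N_norm : homogeneous_norm N) (p : R) (p_ge1 : 1 <= p).
Implicit Types (g h : T) (x y z : R -> T) (D : seq R).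

Let p_gt0 : 0 < p. Proof. exact: lt_le_trans p_ge1. Qed.

Lemma hdist_ge0 g h : G g -> G h -> 0 <= hdist N g h.
Proof. by move=> Gg Gh; apply: (hnorm_ge0 N_norm); exact: free_groupVM. Qed.

Lemma hdistxx g : G g -> hdist N g g = 0.
Proof. by move=> Gg; rewrite /hdist mulVr ?free_group_unit// (hnorm1 N N_norm). Qed.

Lemma hdist_eq0 g h : G g -> G h -> hdist N g h = 0 -> g = h.
Proof.
move=> Gg Gh /(hnorm_eq0 N_norm (free_groupVM _ _ Gg Gh)) /(congr1 ( *%R g)).
by rewrite mulrA divrr ?free_group_unit// mul1r mulr1.
Qed.

Lemma hdistC g h : G g -> G h -> hdist N g h = hdist N h g.
Proof.
move=> Gg Gh; rewrite /hdist -(hnormV N_norm (free_groupVM _ _ Gg Gh)).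
by rewrite invrM ?unitrV ?free_group_unit// invrK.
Qed.

Lemma hdist_triangle h g k : G g -> G h -> G k ->
  hdist N g k <= hdist N g h + hdist N h k.
Proof.
move=> Gg Gh Gk; have := hnormM N_norm (free_groupVM _ _ Gg Gh) (free_groupVM _ _ Gh Gk).
by rewrite -mulrA (mulrA h) divrr ?free_group_unit// mul1r.
Qed.

Definition path_in x := forall t : R, t \in `[0, 1] -> G (x t).

Lemma incr_in x s t : path_in x -> s \in `[0, 1] -> t \in `[0, 1] -> G (incr x s t).
Proof. by move=> Gx s01 t01; apply: free_groupVM; exact: Gx. Qed.

Lemma incr_partition x D i : path_in x -> itv_partition 0 1 D -> (i < size D)%N ->
  G (incr x (nth 1 (0 :: D) i) (nth 1 (0 :: D) i.+1)).
Proof.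
by move=> Gx D01 iD; apply: incr_in => //; apply: itv_partition_point => //; exact: ltnW.
Qed.

Definition pvar_root x y D := pvar_sum N p x y D `^ p^-1.

Lemma pvar_root_triangle y x z D : path_in x -> path_in y -> path_in z ->
  itv_partition 0 1 D -> pvar_root x z D <= pvar_root x y D + pvar_root y z D.
Proof.
move=> Gx Gy Gz D01; have Gp w (i : 'I_(size D)) (Gw : path_in w) := incr_partition w D i Gw D01 (ltn_ord i).
apply: (le_trans _ (minkowski_sum p _ _ _ p_ge1 _ _)); last 2 first.
- by move=> i; exact: hdist_ge0 (Gp _ _ Gx) (Gp _ _ Gy).
- by move=> i; exact: hdist_ge0 (Gp _ _ Gy) (Gp _ _ Gz).
rewrite ge0_ler_powR ?invr_ge0 ?(ltW p_gt0)// ?nnegrE; try by apply: sumr_ge0 => *; exact: powR_ge0.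
apply: ler_sum => i _; rewrite ge0_ler_powR ?(ltW p_gt0) ?nnegrE//.
- exact: hdist_ge0 (Gp _ _ Gx) (Gp _ _ Gz).
- by rewrite addr_ge0//; [exact: hdist_ge0 (Gp _ _ Gx) (Gp _ _ Gy)|exact: hdist_ge0 (Gp _ _ Gy) (Gp _ _ Gz)].
- exact: hdist_triangle (Gp _ _ Gx) (Gp _ _ Gy) (Gp _ _ Gz).
Qed.

Lemma pvar_root_le x y D : itv_partition 0 1 D -> ((pvar_root x y D)%:E <= pvar_dist N p x y)%E.
Proof. by move=> D01; apply: ereal_sup_ubound; exists D. Qed.

Lemma pvar_dist_le x y (M : \bar R) :
  (forall D, itv_partition 0 1 D -> ((pvar_root x y D)%:E <= M)%E) ->
  (pvar_dist N p x y <= M)%E.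
Proof. by move=> DM; apply: ge_ereal_sup => _ [D D01 <-]; exact: DM. Qed.

Lemma pvar_dist_ge0 x y : (0 <= pvar_dist N p x y)%E.
Proof.
apply: le_trans (pvar_root_le x y [:: 1] (itv_partition1 ltr01)).
by rewrite lee_fin powR_ge0.
Qed.

Lemma pvar_dist_triangle y x z : path_in x -> path_in y -> path_in z ->
  (pvar_dist N p x z <= pvar_dist N p x y + pvar_dist N p y z)%E.
Proof.
move=> Gx Gy Gz; apply: pvar_dist_le => D D01.
apply: le_trans (leeD (pvar_root_le x y _ D01) (pvar_root_le y z _ D01)).
by rewrite -EFinD lee_fin; exact: pvar_root_triangle.
Qed.

Lemma pvar_rootC x y D : path_in x -> path_in y -> itv_partition 0 1 D ->
  pvar_root x y D = pvar_root y x D.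
Proof.
move=> Gx Gy D01.
rewrite /pvar_root; suff -> : pvar_sum N p x y D = pvar_sum N p y x D by [].
apply: eq_bigr => i _; rewrite hdistC//.
  exact: (incr_partition _ _ _ Gx D01).
exact: (incr_partition _ _ _ Gy D01).
Qed.

Lemma pvar_distC x y : path_in x -> path_in y -> pvar_dist N p x y = pvar_dist N p y x.
Proof.
move=> Gx Gy; apply/eqP; rewrite eq_le; apply/andP; split;
by apply: pvar_dist_le => D D01; rewrite pvar_rootC//; exact: pvar_root_le.
Qed.

(** Both paths start at 1, so the first summand for the partition 0 < t < 1, or 0 < 1 if t = 1, is
    the p-th power of the distance at t. *)
Lemma hdist_le_pvar x y t : path_in x -> path_in y -> x 0 = 1 -> y 0 = 1 ->
  t \in `[0, 1] -> ((hdist N (x t) (y t))%:E <= pvar_dist N p x y)%E.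
Proof.
move=> Gx Gy x0 y0 t01; have [t0|/eqP t0] := eqVneq t 0.
  by rewrite t0 x0 y0 hdistxx ?pvar_dist_ge0//; exact: free_group1.
have tp : 0 < t by move: t01; rewrite in_itv/= lt_neqAle eq_sym => /andP[-> _]; rewrite andbT; apply/eqP.
have [D [D01 D0]] : exists D, itv_partition 0 1 D /\ ohead D = Some t.
  have [t1|/eqP t1] := eqVneq t 1.
    by exists [:: 1]; rewrite t1; split=> //; exact: itv_partition1.
  exists [:: t; 1]; split=> //; split=> //=; rewrite tp/= andbT lt_neqAle.
  by move: t01; rewrite in_itv/= => /andP[_ ->]; rewrite andbT; apply/eqP.
apply: le_trans (pvar_root_le x y _ D01); case: D D0 D01 => //= _ D [->] D01.
have dE : hdist N (x t) (y t) = (hdist N (x t) (y t) `^ p) `^ p^-1.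
  by rewrite -powRrM mulfV ?gt_eqF// powRr1// hdist_ge0//; [exact: Gx|exact: Gy].
rewrite lee_fin dE ge0_ler_powR ?invr_ge0 ?(ltW p_gt0) ?nnegrE ?powR_ge0//.
  by apply: sumr_ge0 => i _; exact: powR_ge0.
rewrite /pvar_sum big_ord_recl/= /incr x0 y0 invr1 !mul1r lerDl.
by apply: sumr_ge0 => i _; exact: powR_ge0.
Qed.

Lemma group_path_in x : group_path x -> path_in x.
Proof. by case. Qed.

Lemma path_in1 : path_in (cst 1). Proof. by move=> t _; exact: free_group1. Qed.

(** Finiteness comes from the triangle inequality through the constant path, separation from the
    pointwise bound. *)
Lemma pvar_metric : metric_on (pvar_space N p) (fun x y => {in `[0, 1], x =1 y})
  (pvar_dist N p).
Proof.
split=> [x y [/group_path_in Gx x1] [/group_path_in Gy y1]|x y _ _|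
  x y [px x1] [py y1]|x y [/group_path_in Gx _] [/group_path_in Gy _]|
  x y z [/group_path_in Gx _] [/group_path_in Gy _] [/group_path_in Gz _]].
- rewrite (ge0_fin_numE (pvar_dist_ge0 x y)).
  apply: (le_lt_trans (pvar_dist_triangle (cst 1) _ _ Gx path_in1 Gy)).
  rewrite (pvar_distC _ _ path_in1 Gy).
  exact: (lte_add_pinfty x1 y1).
- exact: pvar_dist_ge0.
- have [Gx _ x0] := px; have [Gy _ y0] := py.
  split=> [d0 t t01|xy].
    apply: hdist_eq0; [exact: Gx|exact: Gy|].
    apply/eqP; rewrite eq_le hdist_ge0 ?andbT; [|exact: Gx|exact: Gy].
    by have := hdist_le_pvar _ _ _ (group_path_in _ px) (group_path_in _ py) x0 y0 t01; rewrite d0 lee_fin.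
  apply/eqP; rewrite eq_le pvar_dist_ge0 andbT; apply: pvar_dist_le => D D01.
  rewrite /pvar_root /pvar_sum big1 => [|i _]; first by rewrite powR0// invr_eq0 gt_eqF.
  have t01 j : (j <= size D)%N -> nth 1 (0 :: D) j \in `[0, 1].
    exact: itv_partition_point.
  have si := ltn_ord i.
  have -> : incr x (nth 1 (0 :: D) i) (nth 1 (0 :: D) i.+1) =
            incr y (nth 1 (0 :: D) i) (nth 1 (0 :: D) i.+1).
    by rewrite /incr (xy _ (t01 _ (ltnW si))) (xy _ (t01 _ si)).
  rewrite hdistxx; first by rewrite powR0// gt_eqF.
  exact: (incr_partition y D i Gy D01 si).
- exact: pvar_distC.
- exact: pvar_dist_triangle.
Qed.

End PVariationMetric.

(** * Completeness for the p-variation metric *)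

Section PVariationComplete.
Context {R : realType} {V : normedVectType R} {m : nat}.
Local Notation T := (ttensor V m).
Local Notation G := (@free_group R V m).
Context (N : T -> R) (N_norm : homogeneous_norm N) (p : R) (p_ge1 : 1 <= p).
Implicit Types (g h : T) (x y z : R -> T) (D : seq R).

Lemma hdist_tcvg (I : Type) (F : set_system I) {FF : Filter F} (u : I -> T) h :
  (forall i, G (u i)) -> G h -> hdist N (u i) h @[i --> F] --> 0 -> tcvg F u h.
Proof.
move=> Gu Gh; rewrite (_ : (fun i => hdist N (u i) h) = fun i => N (h^-1 * u i)); last first.
  by apply/funext => i; exact: hdistC.
move=> /(hnorm_small _ N_norm _ _ _ (fun i => free_groupVM _ _ Gh (Gu i))) hu.
have : tcvg F (fun i => h * (h^-1 * u i)) (h * 1) by apply: tcvgM => //; exact: tcvg_cst.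
rewrite mulr1; congr tcvg; apply/funext => i.
by rewrite mulrA divrr ?mul1r// free_group_unit.
Qed.

Section PointwiseLimit.
Context (u : nat -> R -> T) (x : R -> T).
Context (Gu : forall n, path_in (u n)) (Gx : path_in x).
Context (ux : forall t : R, t \in `[0, 1] ->
  hdist N (u n t) (x t) @[n --> \oo] --> 0).

Let ucvg t : t \in `[0, 1] -> tcvg \oo (u^~ t) (x t).
Proof.
by move=> t01; apply: hdist_tcvg; [move=> n; exact: Gu|exact: Gx|exact: ux].
Qed.

(** For a fixed partition only finitely many values of the paths occur, so pointwise convergence and
    continuity of N suffice. *)
Lemma pvar_root_lim y D (e : R) : path_in y -> itv_partition 0 1 D ->
  (\forall n \near \oo, pvar_root N p y (u n) D <= e) -> pvar_root N p y x D <= e.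
Proof.
move=> Gy D01; apply: cvgr_to_le; have p0 : 0 < p by exact: lt_le_trans p_ge1.
have incru n i (iD : (i < size D)%N) := incr_partition (u n) D i (Gu n) D01 iD.
have incrx i (iD : (i < size D)%N) := incr_partition x D i Gx D01 iD.
have incry i (iD : (i < size D)%N) := incr_partition y D i Gy D01 iD.
apply: powR_cvg; rewrite ?invr_gt0//.
- by move=> n; apply: sumr_ge0 => i _; exact: powR_ge0.
- by apply: sumr_ge0 => i _; exact: powR_ge0.
apply: cvgr_sum => i _; apply: powR_cvg => //.
- by move=> n; apply: (hdist_ge0 _ N_norm); [exact: incry|exact: incru].
- by apply: (hdist_ge0 _ N_norm); [exact: incry|exact: incrx].
have t01 j : (j <= size D)%N -> nth 1 (0 :: D) j \in `[0, 1].
  exact: itv_partition_point.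
apply: (hnorm_cvg _ N_norm) => [n||].
- by apply: free_groupVM; [exact: incry|exact: incru].
- by apply: free_groupVM; [exact: incry|exact: incrx].
apply: tcvgM; first exact: tcvg_cst.
have si := ltn_ord i.
apply: tcvgM; last by apply: ucvg; exact: t01.
apply: tcvgV; last by apply: ucvg; apply: t01; exact: ltnW.
- by move=> n; apply: free_group_nil; apply: Gu; apply: t01; exact: ltnW.
- by apply: free_group_nil; apply: Gx; apply: t01; exact: ltnW.
Qed.

End PointwiseLimit.

(* If N (u(r)^-1 x(r)) <= e uniformly then N (x(t)^-1 x(r)) is at most
   2 e + N (u(t)^-1 u(r)), and N detects the topology. *)
Lemma continuous_uniform_lim (u : nat -> R -> T) x :
  (forall n, group_path (u n)) -> path_in x ->
  (forall e, 0 < e -> exists n, forall t : R, t \in `[0, 1] -> hdist N (u n t) (x t) <= e) ->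
  forall s, {within `[0, 1]%classic, continuous (fun t : R => tcoef (x t) s : R)}.
Proof.
move=> Gu Gx ux s; apply/subspace_continuousP => t /= t01.
set F := within _ _.
have FA : \forall r \near F, r \in `[0, 1] by apply: withinT; exact: nbhs_filter.
(* The convergence lemmas ask for group elements at every index, while paths are constrained on
   [0, 1] only. *)
pose ext (y : R -> T) (r : R) := if r \in `[0, 1] then y r else 1.
have extG y r : path_in y -> G (ext y r).
  by move=> Gy; rewrite /ext; case: ifP => [/Gy//|_]; exact: free_group1.
have extE y r : r \in `[0, 1] -> ext y r = y r by rewrite /ext => ->.
suff : tcvg F (ext x) (x t).
  move=> /(_ s); apply: cvg_trans; apply: near_eq_cvg.
  by apply: filterS FA => r /= r01; rewrite extE.
have Gxt : G (x t) by exact: Gx.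
apply: hdist_tcvg => [r|//|]; first exact: extG.
apply/cvgr0Pnorm_le => e e0.
have e3 : 0 < e / 3 by rewrite divr_gt0.
have [n nP] := ux _ e3; have [Gun cun _] := Gu n.
have Gut : G (u n t) by exact: Gun.
have : hdist N (u n t) (ext (u n) r) @[r --> F] --> 0.
  apply: (hnorm_cvg1 _ N_norm) => [r|]; first by apply: free_groupVM => //; exact: extG.
  rewrite -[X in tcvg _ _ X](mulVr (free_group_unit _ Gut)); apply: tcvgM; first exact: tcvg_cst.
  move=> w; have /subspace_continuousP/(_ t t01) := cun w.
  apply: cvg_trans; apply: near_eq_cvg.
  by apply: filterS FA => r /= r01; rewrite extE.
move=> /cvgr0Pnorm_le/(_ _ e3); apply: filterS2 FA => r r01; rewrite !extE//.
have Gur : G (u n r) by exact: Gun.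
have Gxr : G (x r) by exact: Gx.
rewrite !ger0_norm; try exact: (hdist_ge0 _ N_norm).
move=> ur; rewrite (hdistC _ N_norm)//.
apply: (le_trans (hdist_triangle _ N_norm (u n t) _ _ _ _ _)) => //.
apply: (le_trans (lerD (lexx _) (hdist_triangle _ N_norm (u n r) _ _ _ _ _))) => //.
rewrite (hdistC _ N_norm)//; have := nP t t01; have := nP r r01; lra.
Qed.

Lemma pvar_complete : complete_on (pvar_space N p) (pvar_dist N p).
Proof.
move=> u pu uC.
have gu n : group_path (u n) by case: (pu n).
have Gu n : path_in (u n) by exact: group_path_in.
have u0 n : u n 0 = 1 by case: (gu n).
have /boolp.choice[x xP] : forall t : R, exists xt, t \in `[0, 1] ->
    G xt /\ hdist N (u n t) xt @[n --> \oo] --> 0.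
  move=> t; case: (boolP (t \in `[0, 1])) => [t01|]; last by exists 1.
  have [//|e e0|xt Gxt uxt] := free_group_hnorm_complete _ N_norm (u^~ t).
  - by move=> n; exact: Gu.
  - have [n nP] := uC e e0; exists n => i j ni nj; rewrite -lte_fin.
    apply: le_lt_trans (nP _ _ ni nj).
    exact: (hdist_le_pvar _ N_norm _ p_ge1 _ _ _ (Gu i) (Gu j) (u0 i) (u0 j) t01).
  - by exists xt.
have Gx : path_in x by move=> t /xP[].
have ux (t : R) : t \in `[0, 1] -> hdist N (u n t) (x t) @[n --> \oo] --> 0 by move=> /xP[].
(* The partition is fixed before j tends to infinity, and the supremum over partitions is taken
   last; convergence of the sums need not be uniform in D. *)
have unif e : 0 < e -> exists n, forall i, (n <= i)%N ->
    (pvar_dist N p (u i) x <= e%:E)%E.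
  move=> e0; have [n nP] := uC e e0; exists n => i ni; apply: pvar_dist_le => D D01.
  rewrite lee_fin; apply: (pvar_root_lim u x Gu Gx ux) => //.
  exists n => // j /= nj; rewrite -lee_fin.
  exact: le_trans (pvar_root_le _ _ _ _ _ D01) (ltW (nP _ _ ni nj)).
have x0 : x 0 = 1.
  have z01 : (0 : R) \in `[0, 1] by rewrite in_itv/= lexx ler01.
  have u0x : tcvg \oo (u^~ 0) (x 0).
    by apply: hdist_tcvg; [move=> n; exact: Gu|exact: Gx|exact: ux].
  apply: (tcvg_unique _ _ _ u0x); rewrite (_ : u^~ 0 = fun=> 1); first exact: tcvg_cst.
  exact/funext.
have gx : group_path x.
  split=> //; apply: (continuous_uniform_lim u) => // e e0.
  have [n nP] := unif e e0; exists n => t t01; rewrite -lee_fin.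
  apply: le_trans (nP _ (leqnn n)).
  exact: (hdist_le_pvar _ N_norm _ p_ge1 _ _ _ (Gu n) Gx (u0 n) x0 t01).
have px : pvar_space N p x.
  split=> //; have [n nP] := unif 1 ltr01.
  have Gc : path_in (cst 1 : R -> T) := path_in1.
  apply: (le_lt_trans (pvar_dist_triangle _ N_norm _ p_ge1 (u n) _ _ Gx (Gu n) Gc)).
  rewrite (pvar_distC _ N_norm _ x (u n) Gx (Gu n)).
  apply: lte_add_pinfty; last by case: (pu n).
  exact: le_lt_trans (nP _ (leqnn n)) (ltry _).
exists x => //.
have [fin _ _ _ _] := pvar_metric _ N_norm _ p_ge1.
have finux n := fin _ _ (pu n) px.
apply/fine_cvgP; split; first by apply: nearW => n; exact: (finux n).
apply/cvgr0Pnorm_le => e e0; have [n nP] := unif e e0.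
exists n => // i /= ni.
rewrite ger0_norm; last exact: (fine_ge0 (pvar_dist_ge0 _ _ _ _)).
rewrite -lee_fin (fineK (finux i)); exact: (nP i ni).
Qed.

End PVariationComplete.

Theorem theorem25 (R : realType) (V : normedVectType R) (m : nat) (p : R)
    (N : ttensor V m -> R) (m_ge1 : (1 <= m)%N) (p_ge1 : 1 <= p)
    (N_norm : homogeneous_norm N) :
  metric_on (pvar_space N p) (fun x y => {in `[0, 1], x =1 y})
    (pvar_dist N p) /\
  complete_on (pvar_space N p) (pvar_dist N p).
Proof.
by split; [exact: (pvar_metric N N_norm p p_ge1)|exact: (pvar_complete N N_norm p p_ge1)].
Qed.
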